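(* Let $n\ge1$, let $1\le d_m\le d_n\le d_M$ be integers, and let $\mathrm A,\mathrm A_n,\mathrm A_d\in\mathbb R^{n\times n}$. Assume that there exist matrices $\mathrm P_1\in\mathbb S_{4n}^+$, $\mathrm P_2\in\mathbb S_{3n}^+$, $\mathrm Q_{1_j},\mathrm Q_{2_j},\mathrm Z_{1_j},\mathrm Z_{2_j}\in\mathbb S_n^+$ and $\mathrm X_j\in\mathbb R^{2n\times2n}$ for $j\in\{1,2\}$, and $\mathrm Q_{3_1},\mathrm Z_{3_1}\in\mathbb S_n^+$, such that for each $j\in\{1,2\}$ $$\Psi_{z_j}\succ0,\qquad {\Gamma_j^\perp}^\top\Phi(d_{m_j},j)\Gamma_j^\perp\prec0,\qquad {\Gamma_j^\perp}^\top\Phi(d_{M_j},j)\Gamma_j^\perp\prec0,$$ and such that $$\mathcal L^{\perp}(l_1)^\top\big[\mathrm{diag}(\mathrm S_1,0_n)-\mathrm{diag}(0_n,\mathrm S_2)\big]\mathcal L^{\perp}(l_1)\prec0,\quad l_1=d_{m_1},\dots,d_{M_1},$$ $$\mathcal L^{\perp}(l_2)^\top\big[\mathrm{diag}(\mathrm S_2,0_n)-\mathrm{diag}(0_n,\mathrm S_1)\big]\mathcal L^{\perp}(l_2)\prec0,\quad l_2=d_{m_2},\dots,d_{M_2},$$ where $\mathrm S_j=W_{5_j}^\top\mathrm P_jW_{5_j}+\mathcal P_j$ and all the matrices are as defined in the context. Then the switched system $$x(k+1)=f_{\sigma(k)}(\bar x(k),k),\ k\ge0,\qquad x(k)=\phi(k),\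 k\in[-d_M,0],$$ defined in the context (equivalently, $x(k+1)=\mathrm Ax(k)+\mathrm A_nx(k-d_n)+\mathrm A_dx(k-d(k))$) is asymptotically stable for any time-varying delay $d:\mathbb N\to[d_m,d_M]$.
   Context: Notation: $\mathbb S_m^+$ is the set of symmetric positive definite $m\times m$ real matrices; $\prec,\succ$ denote the definiteness order on symmetric matrices; $\mathrm{He}\{Y\}=Y+Y^\top$; $\mathrm{diag}$ denotes block-diagonal matrices; $\mathrm I$ and $0$ are identity and zero matrices ($n\times n$ when the size is not indicated), $0_n$ is the $n\times n$ zero matrix; $\star$ denotes the block determined by symmetry. System. $x(k)\in\mathbb R^n$, $\bar x(k)=[x^\top(k)\ x^\top(k-1)\dots x^\top(k-d_M)]^\top$, $d(k)$ is an integer delay with $d_m\le d(k)\le d_M$. Set $\mathrm A_{m_1}=0$, $\mathrm A_{M_1}=\mathrm A_n$, $d_{m_1}=d_m$, $d_{M_1}=d_n$; $\mathrm A_{m_2}=\mathrm A_n$, $\mathrm A_{M_2}=0$, $d_{m_2}=d_n$, $d_{M_2}=d_M$. For $j\in\{1,2\}$, $f_j(\bar x(k),k)=\mathrm Ax(k)+\mathrm A_{m_j}x(k-d_{m_j})+\mathrm A_{M_j}x(k-d_{M_j})+\mathrm A_dx(k-d(k))$. The switching rule is $\sigma(k)=1$ if $d_m\le d(k)\le d_n$ and $\sigma(k)=2$ if $d_n<d(k)\le d_M$. Scalars: $d_{\Delta_j}=d_{M_j}-d_{m_j}$, $d_{\Delta_M}=d_M-d_{M_1}=d_M-d_n$;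 $\gamma(1)=1$, $\gamma(d)=(d+1)/(d-1)$ for $d>1$. Basic matrices ($n\times n$ blocks): $$M=\begin{bmatrix}0&\mathrm I&-\mathrm I&0&0&0\\0&\mathrm I&\mathrm I&0&0&-2\mathrm I\end{bmatrix},\quad W_\Psi=\begin{bmatrix}[\,0_{2n\times2n}\ \ M\,]\\ [\,0_{2n\times n}\ \ M\ \ 0_{2n\times n}\,]\end{bmatrix},\quad W_s=[\,M\ \ 0_{2n\times2n}\,],\quad W_3=[\,\mathrm I\ -\mathrm I\ 0\ 0\ 0\ 0\ 0\ 0\,],$$ $$W_1(a,b)=\begin{bmatrix}0&\mathrm I&0&0&0&0&0&0\\0&-\mathrm I&0&0&0&(a+1)\mathrm I&0&0\\0&0&-\mathrm I&-\mathrm I&0&0&(1-a)\mathrm I&(b+1)\mathrm I\end{bmatrix},$$ $$W_2(a,b)=\begin{bmatrix}\mathrm I&0&0&0&0&0&0&0\\0&0&-\mathrm I&0&0&(a+1)\mathrm I&0&0\\0&0&0&-\mathrm I&-\mathrm I&0&(1-a)\mathrm I&(b+1)\mathrm I\end{bmatrix},\quad W(d)=\begin{bmatrix}0_{2n\times8n}\\ [\,0_{n\times6n}\ \ d\,\mathrm I\ \ -d\,\mathrm I\,]\end{bmatrix}.$$ For $j=2$ ($8$ block columns): $W_{\Psi_2}=W_\Psi$, $W_{s_2}=W_s$, $W_{3_2}=W_3$, $W_{1_2}=W_1(d_{m_2},d_{M_2})$, $W_{2_2}=W_2(d_{m_2},d_{M_2})$, $W_2(d)=W(d)$ (the symbol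 $W_j(d)$ with the single argument $d$). For $j=1$ ($10$ block columns): $W_{\Psi_1}=[\,W_\Psi\ \ 0_{4n\times2n}\,]$, $W_{s_1}=[\,W_s\ \ 0_{2n\times2n}\,]$, $W_{3_1}=[\,W_3\ \ 0_{n\times2n}\,]$, $$W_{1_1}=\begin{bmatrix}[\,W_1(d_{m_1},d_{M_1})\ \ 0_{3n\times2n}\,]\\ [\,0_{n\times4n}\ -\mathrm I\ \ 0_{n\times4n}\ \ (d_{\Delta_M}+1)\mathrm I\,]\end{bmatrix},\quad W_{2_1}=\begin{bmatrix}[\,W_2(d_{m_1},d_{M_1})\ \ 0_{3n\times2n}\,]\\ [\,0_{n\times8n}\ -\mathrm I\ \ (d_{\Delta_M}+1)\mathrm I\,]\end{bmatrix},$$ $$W_1(d)=\begin{bmatrix}[\,W(d)\ \ 0_{3n\times2n}\,]\\ 0_{n\times10n}\end{bmatrix},\quad W_z=\begin{bmatrix}0_{n\times4n}&\mathrm I&0_{n\times3n}&-\mathrm I&0\\0_{n\times4n}&\mathrm I&0_{n\times3n}&\mathrm I&-2\mathrm I\end{bmatrix}.$$ The matrices of the first conditions: $$\Gamma_1^\perp=\begin{bmatrix}[\,\mathrm A\ \mathrm A_{m_1}\ \mathrm A_d\ \mathrm A_{M_1}\ 0_{n\times5n}\,]\\ \mathrm I_{9n}\end{bmatrix},\quad \Gamma_2^\perp=\begin{bmatrix}[\,\mathrm A\ \mathrm A_{m_2}\ \mathrm A_d\ \mathrm A_{M_2}\ 0_{n\times3n}\,]\\ \mathrm I_{7n}\end{bmatrix},\quad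 \Psi_{z_j}=\begin{bmatrix}\mathscr Z_{2_j}&\mathrm X_j\\ \star&\mathscr Z_{2_j}\end{bmatrix},$$ $\mathscr Z_{1_j}=\mathrm{diag}(\mathrm Z_{1_j},3\gamma(d_{m_j})\mathrm Z_{1_j})$, $\mathscr Z_{2_j}=\mathrm{diag}(\mathrm Z_{2_j},3\mathrm Z_{2_j})$, $\mathscr Z_{3_1}=\mathrm{diag}(\mathrm Z_{3_1},3\mathrm Z_{3_1})$, $\mathcal Q_1=\mathrm{diag}(0,\mathrm Q_{1_1},\mathrm Q_{2_1}-\mathrm Q_{1_1},0,\mathrm Q_{3_1}-\mathrm Q_{2_1},0_{5n\times5n})$, $\mathcal Q_2=\mathrm{diag}(0,\mathrm Q_{1_2},\mathrm Q_{2_2}-\mathrm Q_{1_2},0,-\mathrm Q_{2_2},0_{3n\times3n})$, $$\Phi(d,j)=\Phi_1(d,j)+\mathcal Q_j+\Phi_3(j),\quad \Phi_1(d,j)=W_{2_j}^\top\mathrm P_jW_{2_j}-W_{1_j}^\top\mathrm P_jW_{1_j}+\mathrm{He}\{W_j(d)^\top\mathrm P_j(W_{2_j}-W_{1_j})\},$$ $$\Phi_3(1)=W_{3_1}^\top(d_{m_1}^2\mathrm Z_{1_1}+d_{\Delta_1}^2\mathrm Z_{2_1}+d_{\Delta_M}^2\mathrm Z_{3_1})W_{3_1}-W_{s_1}^\top\mathscr Z_{1_1}W_{s_1}-W_{\Psi_1}^\top\Psi_{z_1}W_{\Psi_1}-W_z^\top\mathscr Z_{3_1}W_z,$$ $$\Phi_3(2)=W_{3_2}^\top(d_{m_2}^2\mathrm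 Z_{1_2}+d_{\Delta_2}^2\mathrm Z_{2_2})W_{3_2}-W_{s_2}^\top\mathscr Z_{1_2}W_{s_2}-W_{\Psi_2}^\top\Psi_{z_2}W_{\Psi_2}.$$ The matrices of the last two conditions. For an integer $l\in[1,d_M]$, $$\mathcal L^\perp(l)=\begin{bmatrix}\mathcal L_a^\perp(l)\\ \mathrm I_{(d_M+1)n}\end{bmatrix},\quad \mathcal L_a^\perp(l)=[\,\mathrm A\ 0\cdots0\ \mathrm A_n\ 0\cdots0\,]+\mathrm A_d[\,0\ \ \delta(1)\mathrm I\ \cdots\ \delta(d_M)\mathrm I\,],$$ where the blocks of $\mathcal L_a^\perp(l)$ are numbered $0,\dots,d_M$ (block $i$ multiplies $x(k-i)$), $\mathrm A_n$ is in block $d_n$, and $\delta(i)=1$ if $i=l$, $\delta(i)=0$ otherwise. $W_{5_j}$ has $d_M+1$ block columns numbered $0,\dots,d_M$. Its first block row has $\mathrm I$ in block $0$ and zeros elsewhere; its second has $\mathrm I$ in blocks $1,\dots,d_{m_j}$ and zeros elsewhere; its third has $\mathrm I$ in blocks $d_{m_j}+1,\dots,d_{M_j}$ and zeros elsewhere; for $j=1$ only, there is a fourth block row with $\mathrm I$ in blocks $d_{M_1}+1,\dots,d_M$ and zeros elsewhere. $\mathcal P_1=\mathrm{diag}(\mathcal H_1,\mathrm Q_{3_1},\dots,\mathrm Q_{3_1})+\mathcal H_a$ with $d_M-d_{M_1}$ copies of $\mathrm Q_{3_1}$, and $\mathcal P_2=\mathcal H_2$. Here $\mathcal H_j$ is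 the symmetric block tridiagonal matrix with block rows and columns $0,\dots,d_{M_j}$ whose diagonal blocks are, in order, $\mathcal P_0,\mathcal P_{a_1},\dots,\mathcal P_{a_{d_{m_j}}},\mathcal P_{c_1},\dots,\mathcal P_{c_{d_{\Delta_j}}}$ and whose superdiagonal blocks are, in order, $\mathcal P_{b_1},\dots,\mathcal P_{b_{d_{m_j}}},\mathcal P_{d_1},\dots,\mathcal P_{d_{d_{\Delta_j}}}$, with $\mathcal P_0=\mathrm Z_{1_j}d_{m_j}^2+\mathrm Z_{2_j}d_{\Delta_j}^2$, $\mathcal P_{a_i}=\mathrm Q_{1_j}+2\mathrm Z_{2_j}d_{\Delta_j}^2+\mathrm Z_{1_j}d_{m_j}(2d_{m_j}-2i+1)$, $\mathcal P_{b_i}=-\mathrm Z_{2_j}d_{\Delta_j}^2-\mathrm Z_{1_j}d_{m_j}(d_{m_j}-i+1)$, $\mathcal P_{c_l}=\mathrm Q_{2_j}+\mathrm Z_{2_j}d_{\Delta_j}(2d_{\Delta_j}-2l+1)$, $\mathcal P_{d_l}=-\mathrm Z_{2_j}d_{\Delta_j}(d_{\Delta_j}-l+1)$, for $i\in[1,d_{m_j}]$, $l\in[1,d_{\Delta_j}]$. $\mathcal H_a$ is the symmetric block tridiagonal matrix with block rows and columns $0,\dots,d_M$ of the same format, with diagonal blocks $\mathcal P_0,\mathcal P_{a_1},\dots,\mathcal P_{a_{d_{M_1}}},\mathcal P_{c_1},\dots,\mathcal P_{c_{d_{\Delta_M}}}$ and superdiagonal blocks $\mathcal P_{b_1},\dots,\mathcal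 P_{b_{d_{M_1}}},\mathcal P_{d_1},\dots,\mathcal P_{d_{d_{\Delta_M}}}$, where now $\mathcal P_0=\mathrm Z_{3_1}d_{\Delta_M}^2$, $\mathcal P_{a_i}=2\mathrm Z_{3_1}d_{\Delta_M}^2$, $\mathcal P_{b_i}=-\mathrm Z_{3_1}d_{\Delta_M}^2$, $\mathcal P_{c_l}=\mathrm Z_{3_1}d_{\Delta_M}(2d_{\Delta_M}-2l+1)$, $\mathcal P_{d_l}=-\mathrm Z_{3_1}d_{\Delta_M}(d_{\Delta_M}-l+1)$. *)

(* Defs.v *)
From HB Require Import structures.
From mathcomp Require Import all_boot all_order all_algebra.
From mathcomp Require Import all_classical all_reals all_analysis.

Set Implicit Arguments.
Unset Strict Implicit.
Unset Printing Implicit Defensive.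

Import Order.TTheory GRing.Theory Num.Theory.
Import numFieldNormedType.Exports.

Local Open Scope classical_set_scope.
Local Open Scope ring_scope.

Section Definiteness.
Variable R : realType.

Definition posdefmx m (M : 'M[R]_m) : Prop :=
  M^T = M /\ forall v : 'cV[R]_m, v != 0 -> 0 < (v^T *m M *m v) 0 0.

Definition loewner_lt m (M N : 'M[R]_m) : Prop := posdefmx (N - M).

Definition He m (Y : 'M[R]_m) : 'M[R]_m := Y + Y^T.

End Definiteness.

Notation "M \prec N" := (loewner_lt M N) (at level 70, no associativity) : ring_scope.

(* A p x q array of n x n blocks is handled as a matrix over the ring of
   n x n matrices, so that 0, 1 and c%:M below are n x n blocks. [flat] turns it
   into a real matrix. The size pn of the latter is written \sum_(i < p) n, as
   in the library's block matrices. *)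
Section Blocks.
Variables (R : realType) (n : nat).

Definition barray p q (s : seq (seq 'M[R]_n)) : 'M['M[R]_n]_(p, q) :=
  \matrix_(i, j) nth 0 (nth [::] s i) j.

Definition flat p q (B : 'M['M[R]_n]_(p, q)) :
    'M[R]_(\sum_(i < p) n, \sum_(j < q) n) :=
  \mxblock_(i < p, j < q) B i j.

Definition flat_row q (B : 'M['M[R]_n]_(1, q)) : 'M[R]_(n, \sum_(j < q) n) :=
  \mxrow_(j < q) B 0 j.

Definition bdiag p (s : seq 'M[R]_n) : 'M[R]_(\sum_(i < p) n) :=
  \mxdiag_(i < p) nth 0 s i.

End Blocks.

(* The index j of the two subsystems. *)
Inductive mode := One | Two.

Section DelayBounds.
Variables (dm dn dM : nat).

Definition dlo (j : mode) : nat := match j with One => dm | Two => dn end.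
Definition dhi (j : mode) : nat := match j with One => dn | Two => dM end.
Definition dDelta (j : mode) : nat := (dhi j - dlo j)%N.
Definition dDeltaM : nat := (dM - dhi One)%N.

End DelayBounds.

Section BasicMatrices.
Variables (R : realType) (n : nat).
Local Notation arr p q := ('M['M[R]_n]_(p, q)).

Definition gamma (d : nat) : R :=
  if d == 1%N then 1 else (d%:R + 1) / (d%:R - 1).

Definition Mbase : arr 2 6 := barray 2 6
  [:: [:: 0; 1; -1; 0; 0; 0];
      [:: 0; 1; 1; 0; 0; (- 2)%:M]].

(* The two block rows of W_Psi, each made of 2 rows of n x n blocks. *)
Definition WPsi_up : arr 2 8 := row_mx (0 : arr 2 2) Mbase.
Definition WPsi_dn : arr 2 8 := row_mx (row_mx (0 : arr 2 1) Mbase) (0 : arr 2 1).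

Definition Ws : arr 2 8 := row_mx Mbase (0 : arr 2 2).

Definition W3 : arr 1 8 := barray 1 8 [:: [:: 1; -1; 0; 0; 0; 0; 0; 0]].

Definition W1ab (a b : R) : arr 3 8 := barray 3 8
  [:: [:: 0; 1; 0; 0; 0; 0; 0; 0];
      [:: 0; -1; 0; 0; 0; (a + 1)%:M; 0; 0];
      [:: 0; 0; -1; -1; 0; 0; (1 - a)%:M; (b + 1)%:M]].

Definition W2ab (a b : R) : arr 3 8 := barray 3 8
  [:: [:: 1; 0; 0; 0; 0; 0; 0; 0];
      [:: 0; 0; -1; 0; 0; (a + 1)%:M; 0; 0];
      [:: 0; 0; 0; -1; -1; 0; (1 - a)%:M; (b + 1)%:M]].

Definition Wd (d : R) : arr 3 8 :=
  col_mx (0 : arr 2 8)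
         (barray 1 8 [:: [:: 0; 0; 0; 0; 0; 0; d%:M; (- d)%:M]]).

End BasicMatrices.

Section Conditions.
Variables (R : realType) (n dm dn dM : nat).
Local Notation arr p q := ('M['M[R]_n]_(p, q)).
Local Notation sq p := ('M[R]_(\sum_(i < p) n)).

Local Notation lo j := (dlo dm dn j).
Local Notation hi j := (dhi dn dM j).
Local Notation dD j := (dDelta dm dn dM j).
Local Notation dDM := (dDeltaM dn dM).

Variables (A An Ad : 'M[R]_n).

Definition Alo (j : mode) : 'M[R]_n := match j with One => 0 | Two => An end.
Definition Ahi (j : mode) : 'M[R]_n := match j with One => An | Two => 0 end.

(* Switched system; [xb i] is the block x(k - i) of the extended state. *)

Definition history (x : int -> 'cV[R]_n) (k : nat) : nat -> 'cV[R]_n :=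
  fun i => x (k%:Z - i%:Z).

Definition fsys (d : nat -> nat) (j : mode) (xb : nat -> 'cV[R]_n) (k : nat) :
    'cV[R]_n :=
  A *m xb 0%N + Alo j *m xb (lo j) + Ahi j *m xb (hi j) + Ad *m xb (d k).

(* The delay is assumed to take values in [dm, dM]. *)
Definition sigma (d : nat -> nat) (k : nat) : mode :=
  if (dm <= d k <= dn)%N then One else Two.

Definition switched_solution (d : nat -> nat) (phi x : int -> 'cV[R]_n) : Prop :=
  (forall k : nat, x (k%:Z + 1) = fsys d (sigma d k) (history x k) k) /\
  (forall k : int, - dM%:Z <= k <= 0 -> x k = phi k).

(* Lyapunov stability of the origin together with attractivity. The system
   being linear, attractivity is required from every initial condition. *)
Definition asymptotically_stable (d : nat -> nat) : Prop :=
  (forall e : R, 0 < e -> exists2 delta : R, 0 < delta &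
     forall phi x : int -> 'cV[R]_n, switched_solution d phi x ->
       (forall k : int, - dM%:Z <= k <= 0 -> `|phi k| < delta) ->
       forall k : nat, `|x k%:Z| < e) /\
  (forall phi x : int -> 'cV[R]_n, switched_solution d phi x ->
     x k%:Z @[k --> \oo] --> (0 : 'cV[R]_n)).

(* Suffixes One and Two stand for j = 1 and j = 2.
   [WdOne] and [WdTwo] are W_j(d), with a single argument. *)

Definition WPsiOne :
    'M[R]_(\sum_(i < 2) n + \sum_(i < 2) n, \sum_(i < 10) n) :=
  col_mx (flat (row_mx (WPsi_up R n) (0 : arr 2 2)))
         (flat (row_mx (WPsi_dn R n) (0 : arr 2 2))).
Definition WsOne := flat (row_mx (Ws R n) (0 : arr 2 2) : arr 2 10).
Definition W3One := flat_row (row_mx (W3 R n) (0 : arr 1 2) : arr 1 10).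

Definition W1One := flat (col_mx
  (row_mx (W1ab n (lo One)%:R (hi One)%:R) (0 : arr 3 2))
  (barray 1 10 [:: [:: 0; 0; 0; 0; -1; 0; 0; 0; 0; (dDM%:R + 1)%:M]])
  : arr 4 10).
Definition W2One := flat (col_mx
  (row_mx (W2ab n (lo One)%:R (hi One)%:R) (0 : arr 3 2))
  (barray 1 10 [:: [:: 0; 0; 0; 0; 0; 0; 0; 0; -1; (dDM%:R + 1)%:M]])
  : arr 4 10).
Definition WdOne (d : nat) := flat (col_mx
  (row_mx (Wd n d%:R) (0 : arr 3 2))
  (0 : arr 1 10)
  : arr 4 10).
Definition Wz := flat (barray 2 10
  [:: [:: 0; 0; 0; 0; 1; 0; 0; 0; -1; 0];
      [:: 0; 0; 0; 0; 1; 0; 0; 0; 1; (- 2)%:M]] : arr 2 10).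

Definition WPsiTwo :
    'M[R]_(\sum_(i < 2) n + \sum_(i < 2) n, \sum_(i < 8) n) :=
  col_mx (flat (WPsi_up R n)) (flat (WPsi_dn R n)).
Definition WsTwo := flat (Ws R n).
Definition W3Two := flat_row (W3 R n).
Definition W1Two := flat (W1ab n (lo Two)%:R (hi Two)%:R : arr 3 8).
Definition W2Two := flat (W2ab n (lo Two)%:R (hi Two)%:R : arr 3 8).
Definition WdTwo (d : nat) := flat (Wd n d%:R : arr 3 8).

Definition GammaOne := flat (col_mx
  (barray 1 9 [:: [:: A; Alo One; Ad; Ahi One; 0; 0; 0; 0; 0]])
  1%:M : arr 10 9).
Definition GammaTwo := flat (col_mx
  (barray 1 7 [:: [:: A; Alo Two; Ad; Ahi Two; 0; 0; 0]])
  1%:M : arr 8 7).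

(* Decision variables; [Q3], [Z3] only occur for j = 1. *)
Variables (P1 : sq 4) (P2 : sq 3) (Q1 Q2 Z1 Z2 : mode -> 'M[R]_n).
Variables (X : mode -> sq 2) (Q3 Z3 : 'M[R]_n).

Definition calZ1 (j : mode) : sq 2 :=
  bdiag 2 [:: Z1 j; (3 * gamma R (lo j)) *: Z1 j].
Definition calZ2 (j : mode) : sq 2 := bdiag 2 [:: Z2 j; 3 *: Z2 j].
Definition calZ3 : sq 2 := bdiag 2 [:: Z3; 3 *: Z3].

Definition Psiz (j : mode) : 'M[R]_(\sum_(i < 2) n + \sum_(i < 2) n) :=
  block_mx (calZ2 j) (X j) (X j)^T (calZ2 j).

Definition calQOne : sq 10 := bdiag 10
  [:: 0; Q1 One; Q2 One - Q1 One; 0; Q3 - Q2 One; 0; 0; 0; 0; 0].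
Definition calQTwo : sq 8 := bdiag 8
  [:: 0; Q1 Two; Q2 Two - Q1 Two; 0; - Q2 Two; 0; 0; 0].

Definition Phi1 p q (P : 'M[R]_p) (W1 W2 Wd : 'M[R]_(p, q)) : 'M[R]_q :=
  W2^T *m P *m W2 - W1^T *m P *m W1 + He (Wd^T *m P *m (W2 - W1)).

Definition Phi3One : sq 10 :=
  W3One^T *m ((lo One)%:R ^+ 2 *: Z1 One + (dD One)%:R ^+ 2 *: Z2 One
              + dDM%:R ^+ 2 *: Z3) *m W3One
  - WsOne^T *m calZ1 One *m WsOne
  - WPsiOne^T *m Psiz One *m WPsiOne
  - Wz^T *m calZ3 *m Wz.
Definition Phi3Two : sq 8 :=
  W3Two^T *m ((lo Two)%:R ^+ 2 *: Z1 Two + (dD Two)%:R ^+ 2 *: Z2 Two) *m W3Two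
  - WsTwo^T *m calZ1 Two *m WsTwo
  - WPsiTwo^T *m Psiz Two *m WPsiTwo.

Definition PhiOne (d : nat) : sq 10 :=
  Phi1 P1 W1One W2One (WdOne d) + calQOne + Phi3One.
Definition PhiTwo (d : nat) : sq 8 :=
  Phi1 P2 W1Two W2Two (WdTwo d) + calQTwo + Phi3Two.

(* Block (i, k) of the symmetric block tridiagonal matrix with diagonal
   T0, Ta 1, ..., Ta m, Tc 1, Tc 2, ... and superdiagonal
   Tb 1, ..., Tb m, Td 1, Td 2, ... *)
Definition btridiag (m : nat) (T0 : 'M[R]_n) (Ta Tb Tc Td : nat -> 'M[R]_n)
    (i k : nat) : 'M[R]_n :=
  let D i := if i == 0%N then T0 else if (i <= m)%N then Ta i else Tc (i - m)%N in
  let U i := if (i <= m)%N then Tb i else Td (i - m)%N in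
  if i == k then D i
  else if k == i.+1 then U k
  else if i == k.+1 then (U i)^T
  else 0.

Definition calH (j : mode) : nat -> nat -> 'M[R]_n :=
  let m : R := (lo j)%:R in
  let D : R := (dD j)%:R in
  btridiag (lo j)
    (m ^+ 2 *: Z1 j + D ^+ 2 *: Z2 j)
    (fun i => Q1 j + (2 * D ^+ 2) *: Z2 j + (m * (2 * m - 2 * i%:R + 1)) *: Z1 j)
    (fun i => - (D ^+ 2 *: Z2 j) - (m * (m - i%:R + 1)) *: Z1 j)
    (fun l => Q2 j + (D * (2 * D - 2 * l%:R + 1)) *: Z2 j)
    (fun l => - ((D * (D - l%:R + 1)) *: Z2 j)).

Definition calHa : nat -> nat -> 'M[R]_n :=
  let D : R := dDM%:R in
  btridiag (hi One)
    (D ^+ 2 *: Z3)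
    (fun _ => (2 * D ^+ 2) *: Z3)
    (fun _ => - (D ^+ 2 *: Z3))
    (fun l => (D * (2 * D - 2 * l%:R + 1)) *: Z3)
    (fun l => - ((D * (D - l%:R + 1)) *: Z3)).

(* The first summand is diag(H_1, Q3, ..., Q3), where H_1 has the block rows and
   columns 0, ..., hi One. *)
Definition calPOne : sq dM.+1 :=
  \mxblock_(i < dM.+1, k < dM.+1)
    (if (i <= hi One)%N && (k <= hi One)%N then calH One i k
     else if i == k then Q3 else 0)
  + \mxblock_(i < dM.+1, k < dM.+1) calHa i k.
Definition calPTwo : sq dM.+1 := \mxblock_(i < dM.+1, k < dM.+1) calH Two i k.

Definition W5One : 'M[R]_(\sum_(r < 4) n, \sum_(i < dM.+1) n) :=
  \mxblock_(r < 4, i < dM.+1)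
    (if nth false [:: i == 0 :> nat;
                      0 < i <= lo One;
                      lo One < i <= hi One;
                      hi One < i <= dM]%N r
     then 1 else 0 : 'M[R]_n).
Definition W5Two : 'M[R]_(\sum_(r < 3) n, \sum_(i < dM.+1) n) :=
  \mxblock_(r < 3, i < dM.+1)
    (if nth false [:: i == 0 :> nat;
                      0 < i <= lo Two;
                      lo Two < i <= hi Two]%N r
     then 1 else 0 : 'M[R]_n).

Definition SOne : sq dM.+1 := W5One^T *m P1 *m W5One + calPOne.
Definition STwo : sq dM.+1 := W5Two^T *m P2 *m W5Two + calPTwo.

(* diag(S, 0_n) and diag(0_n, S); the former is cast to the size of the latter. *)
Definition diagS0 N (S : 'M[R]_N) : 'M[R]_(n + N) :=
  castmx (addnC N n, addnC N n) (block_mx S 0 0 (0 : 'M[R]_n)).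
Definition diag0S N (S : 'M[R]_N) : 'M[R]_(n + N) :=
  block_mx (0 : 'M[R]_n) 0 0 S.

Definition La (l : nat) : 'M[R]_(n, \sum_(i < dM.+1) n) :=
  \mxrow_(i < dM.+1) ((if i == 0 :> nat then A else 0)
                      + (if i == dn :> nat then An else 0))
  + Ad *m \mxrow_(i < dM.+1)
            (if (0 < i)%N && (i == l :> nat) then 1 else 0 : 'M[R]_n).

Definition Lperp (l : nat) :
    'M[R]_(n + \sum_(i < dM.+1) n, \sum_(i < dM.+1) n) :=
  col_mx (La l) 1%:M.

End Conditions.

(* Main.v *)
(* With [eta l = x l - x (l - 1)], [S_j] is the matrix of the Lyapunov-Krasovskii
   functional [V_j], made of a quadratic form in the current state and the sums
   of the delayed states, sums of [x^T Q x], and double sums of [eta^T Z eta].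
   While mode [j] is active, a Wirtinger-type summation inequality and the
   reciprocally convex bound give [V_j(k+1) - V_j(k) <= xi^T Phi(d(k), j) xi],
   which is affine in [d(k)] and hence negative on the whole range of the mode.
   The last two conditions say that entering mode [j] also brings [V_j] below
   the other functional. So [V_j(k+1)] lies below both [V_1(k)] and [V_2(k)],
   and [min(V_1, V_2)] is a common Lyapunov function, whatever the switching. *)

Require Import Defs.
From HB Require Import structures.
From mathcomp Require Import all_boot all_order all_algebra.
From mathcomp Require Import all_classical all_reals all_analysis.
From mathcomp Require Import ring lra zify.

Set Implicit Arguments.
Unset Strict Implicit.
Unset Printing Implicit Defensive.

Import Order.TTheory GRing.Theory Num.Theory.
Import numFieldNormedType.Exports.

Local Open Scope ring_scope.

(** * Quadratic forms *)

(** All estimates concern an arbitrary sequence [y], with [y i] in the place of x(k - i). One time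
    step is [cshift], and the vector it puts in front stays free until [GammaOne], [GammaTwo] or
    [Lperp] makes it the next state. The obstacle is that the functionals and [Phi] live on
    differently stacked vectors: the whole window x(k), ..., x(k - dM) for the former, a few delayed
    states and segment means for the latter. Both are unfolded to scalars, block rows becoming
    explicit combinations of vectors and double sums becoming single sums with coefficients
    [weight]. The decrement is then linear arithmetic between these scalars. The means are any
    vectors satisfying [is_mean], so the block identities remain linear and segments reduced to one
    point need no separate layout. Only x(k) has to be controlled from below; the whole window
    enters once, in the upper bound at time 0. *)

Section Forms.
Variable R : realType.

Definition bil m (M : 'M[R]_m) (u v : 'cV[R]_m) : R := (u^T *m M *m v) 0 0.
Definition qf m (M : 'M[R]_m) (v : 'cV[R]_m) : R := bil M v v.

Section FixedSize.
Variable m : nat.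
Implicit Types (M N : 'M[R]_m) (u v w : 'cV[R]_m).

Lemma bilDl M u v w : bil M (u + v) w = bil M u w + bil M v w.
Proof. by rewrite /bil linearD /= !mulmxDl mxE. Qed.

Lemma bilDr M u v w : bil M u (v + w) = bil M u v + bil M u w.
Proof. by rewrite /bil mulmxDr mxE. Qed.

Lemma bilZl M a u v : bil M (a *: u) v = a * bil M u v.
Proof. by rewrite /bil linearZ /= -!scalemxAl mxE. Qed.

Lemma bilZr M a u v : bil M u (a *: v) = a * bil M u v.
Proof. by rewrite /bil -scalemxAr mxE. Qed.

Lemma bilNl M u v : bil M (- u) v = - bil M u v.
Proof. by rewrite -scaleN1r bilZl mulN1r. Qed.

Lemma bilNr M u v : bil M u (- v) = - bil M u v.
Proof. by rewrite -scaleN1r bilZr mulN1r. Qed.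

Lemma bil0l M v : bil M 0 v = 0.
Proof. by rewrite -(scale0r 0) bilZl mul0r. Qed.

Lemma bil0r M v : bil M v 0 = 0.
Proof. by rewrite -(scale0r 0) bilZr mul0r. Qed.

Lemma bilD M N u v : bil (M + N) u v = bil M u v + bil N u v.
Proof. by rewrite /bil mulmxDr mulmxDl mxE. Qed.

Lemma bilZ a M u v : bil (a *: M) u v = a * bil M u v.
Proof. by rewrite /bil -scalemxAr -scalemxAl mxE. Qed.

Lemma bilN M u v : bil (- M) u v = - bil M u v.
Proof. by rewrite -scaleN1r bilZ mulN1r. Qed.

Lemma bil0 u v : bil (0 : 'M[R]_m) u v = 0.
Proof. by rewrite /bil mulmx0 mul0mx mxE. Qed.

Lemma bil_tr M u v : bil M^T u v = bil M v u.
Proof.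
rewrite /bil; have -> : u^T *m M^T *m v = (v^T *m M *m u)^T.
  by rewrite !trmx_mul trmxK mulmxA.
by rewrite mxE.
Qed.

Lemma bil_sym M u v : M^T = M -> bil M u v = bil M v u.
Proof. by move=> {1}<-; exact: bil_tr. Qed.

Lemma qfD M N v : qf (M + N) v = qf M v + qf N v. Proof. exact: bilD. Qed.
Lemma qfN M v : qf (- M) v = - qf M v. Proof. exact: bilN. Qed.
Lemma qfB M N v : qf (M - N) v = qf M v - qf N v.
Proof. by rewrite qfD qfN. Qed.
Lemma qfZ a M v : qf (a *: M) v = a * qf M v. Proof. exact: bilZ. Qed.
Lemma qf0 v : qf (0 : 'M[R]_m) v = 0. Proof. exact: bil0. Qed.
Lemma qf0r M : qf M 0 = 0. Proof. exact: bil0r. Qed.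
Lemma qf_He M v : qf (He M) v = 2 * qf M v.
Proof. by rewrite qfD {2}/qf bil_tr -/(qf M v); ring. Qed.

Lemma qf_add M u v : M^T = M -> qf M (u + v) = qf M u + 2 * bil M u v + qf M v.
Proof.
by move=> sM; rewrite /qf bilDl !bilDr (bil_sym v u sM); ring.
Qed.

Lemma posdef_qf_ge0 M v : posdefmx M -> 0 <= qf M v.
Proof.
case=> _ pM; have [->|v0] := eqVneq v 0; first by rewrite qf0r.
exact/ltW/pM.
Qed.

Lemma posdef_cauchy_schwarz M u v : posdefmx M ->
  bil M u v ^+ 2 <= qf M u * qf M v.
Proof.
move=> pM; have [sM _] := pM.
have [->|u0] := eqVneq u 0; first by rewrite bil0l qf0r; lra.
have qu : 0 < qf M u by apply: pM.2.
(* This is [qf M u] times the component of [v] that is [M]-orthogonal to [u], written without a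
   division. *)
have := posdef_qf_ge0 (qf M u *: v + (- bil M u v) *: u) pM.
rewrite qf_add // /qf !bilZl !bilZr -!/(qf _ _) (bil_sym v u sM).
set b := bil M u v; set a := qf M u; set c := qf M v.
have -> : a * (a * c) + 2 * (a * (- b * b)) + - b * (- b * a)
   = a * (a * c - b ^+ 2) by ring.
by rewrite pmulr_rge0 // subr_ge0.
Qed.

End FixedSize.

Lemma bil_mul p q (W1 W2 : 'M[R]_(p, q)) (P : 'M[R]_p) u v :
  bil (W1^T *m P *m W2) u v = bil P (W1 *m u) (W2 *m v).
Proof. by rewrite /bil trmx_mul !mulmxA. Qed.

Lemma qf_mul p q (W : 'M[R]_(p, q)) (P : 'M[R]_p) v :
  qf (W^T *m P *m W) v = qf P (W *m v).
Proof. exact: bil_mul. Qed.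

Lemma posdef_unitmx m (M : 'M[R]_m) : posdefmx M -> M \in unitmx.
Proof.
case=> sM pM; rewrite -row_free_unit -kermx_eq0; apply/eqP/row_matrixP => i.
rewrite row0; apply/eqP/negP => /negP ker0.
have k0 : (row i (kermx M))^T != 0 by rewrite trmx_eq0.
have := pM _ k0; rewrite trmxK -row_mul mulmx_ker row0 mul0mx mxE.
by rewrite ltxx.
Qed.

(* [v_i = B(M^-1 e_i, v)], so Cauchy-Schwarz for [M] bounds each coordinate;
   no compactness is needed. *)
Lemma posdef_coord m (M : 'M[R]_m) : posdefmx M ->
  exists2 c : R, 0 < c & forall (v : 'cV[R]_m) i, c * v i 0 ^+ 2 <= qf M v.
Proof.
move=> pM; have uM := posdef_unitmx pM; have [sM _] := pM.
pose e i : 'cV[R]_m := invmx M *m delta_mx i 0.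
pose K := 1 + \sum_i qf M (e i).
have q0 i : 0 <= qf M (e i) by exact: posdef_qf_ge0.
have K0 : 0 < K by rewrite ltr_pwDl // sumr_ge0.
exists K^-1; first by rewrite invr_gt0.
move=> v i; rewrite mulrC ler_pdivrMr // mulrC.
have -> : v i 0 = bil M (e i) v.
  rewrite /bil /e trmx_mul trmx_inv sM mulmxKV //.
  by rewrite trmx_delta -rowE mxE.
apply: le_trans (posdef_cauchy_schwarz (e i) v pM) _.
rewrite ler_wpM2r ?posdef_qf_ge0 // /K (bigD1 i) //= addrCA lerDl.
by rewrite addr_ge0 ?sumr_ge0.
Qed.

Lemma qf_bound m (M : 'M[R]_m) :
  exists2 C : R, 0 <= C & forall (v : 'cV[R]_m) r,
    (forall i, `|v i 0| <= r) -> qf M v <= C * r ^+ 2.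
Proof.
exists (\sum_j \sum_i `|M i j|); first by do 2!apply: sumr_ge0 => ? _.
move=> v r vr; rewrite /qf /bil mxE mulr_suml ler_sum // => j _.
rewrite mxE !mulr_suml ler_sum // => i _; rewrite mxE.
apply: le_trans (ler_norm _) _; rewrite !normrM expr2.
rewrite [`|v i 0| * _]mulrC -!mulrA ler_wpM2l //.
by apply: ler_pM.
Qed.

End Forms.

Lemma cV_norm_lt (R : realType) n (v : 'cV[R]_n) (e : R) :
  0 < e -> (forall i, `|v i 0| < e) -> `|v| < e.
Proof.
move=> e0 ve; rewrite /Num.Def.normr /= mx_normrE.
by apply: bigmax_lt => // -[i j] _ /=; rewrite ord1.
Qed.

Lemma cV_norm_coord (R : realType) n (v : 'cV[R]_n) i : `|v i 0| <= `|v|.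
Proof.
rewrite {2}/Num.Def.normr /= mx_normrE.
exact: (le_bigmax _ (fun p : 'I_n * 'I_1 => `|v p.1 p.2|) (i, 0)).
Qed.

(** A nonincreasing nonnegative sequence converges, so its decrements tend to 0, and they dominate
    [c] times the square of each coordinate. *)
Lemma lyapunov_cvg0 (R : realType) n (x : nat -> 'cV[R]_n) (W : nat -> R) (c : R) :
  0 < c -> (forall k, 0 <= W k) ->
  (forall k i, W k.+1 <= W k - c * x k i 0 ^+ 2) ->
  (forall k, W k.+1 <= W k) ->
  (x k @[k --> \oo] --> (0 : 'cV[R]_n))%classic.
Proof.
move=> c0 W0 dW nW.
have cW : (cvg (W k @[k --> \oo]))%classic.
  apply: nonincreasing_is_cvgn; first by apply/nonincreasing_seqP.
  by exists 0 => _ [k _ <-].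
have dW0 : ((W k - W k.+1) @[k --> \oo] --> (0 : R))%classic.
  rewrite -(subrr (limn W)); apply: cvgB => //.
  by rewrite (cvg_shiftS W).
apply/cvgr0Pnorm_lt => e e0.
have ce : 0 < c * e ^+ 2 by rewrite mulr_gt0 // exprn_gt0.
have /cvgr0Pnorm_lt/(_ _ ce) := dW0.
apply: filterS => k; rewrite ger0_norm ?subr_ge0 // => lt_k.
apply: cV_norm_lt => // i.
rewrite -(ltr_pXn2r (n := 2)) ?nnegrE ?normr_ge0 ?ltW //.
rewrite real_normK ?num_real // -(ltr_pM2l c0).
by apply: le_lt_trans lt_k; have := dW k i; lra.
Qed.

(** * Block vectors and block matrices *)

Section BlockVectors.
Variables (R : realType) (n : nat).
Local Notation arr p q := ('M['M[R]_n]_(p, q)).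
Local Notation cV := ('cV[R]_n).

Definition bvec p (s : seq cV) : 'cV[R]_(\sum_(i < p) n) :=
  \mxcol_(i < p) nth 0 s i.

(** Using lists instead of indexed sums lets a block row given by its entries be evaluated by
    rewriting: [bdot_simp] removes the blocks 0, 1, -1 and [a%:M] one at a time. *)
Fixpoint bdot (r : seq 'M[R]_n) (s : seq cV) : cV :=
  match r, s with
  | a :: r', v :: s' => a *m v + bdot r' s'
  | _, _ => 0
  end.

Lemma bdot0 v r s : bdot (0 :: r) (v :: s) = bdot r s.
Proof. by rewrite /= mul0mx add0r. Qed.

Lemma bdot1 v r s : bdot (1 :: r) (v :: s) = v + bdot r s.
Proof. by rewrite /= mul1mx. Qed.

Lemma bdotN1 v r s : bdot (-1 :: r) (v :: s) = - v + bdot r s.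
Proof. by rewrite /= mulNmx mul1mx. Qed.

Lemma bdotZ a v r s : bdot (a%:M :: r) (v :: s) = a *: v + bdot r s.
Proof. by rewrite /= mul_scalar_mx. Qed.

Lemma bdot_nil s : bdot [::] s = 0. Proof. by []. Qed.

Definition bdot_simp := (bdot0, bdot1, bdotN1, bdotZ, bdot_nil).

Lemma bdotE q r s : (size s <= q)%N ->
  \sum_(i < q) nth 0 r i *m nth 0 s i = bdot r s.
Proof.
elim: s q r => [|v s IH] q [|a r] /= sq.
- by rewrite big1 // => i _; rewrite nth_nil mul0mx.
- by rewrite big1 // => i _; rewrite nth_nil mulmx0.
- by rewrite big1 // => i _; rewrite nth_nil mul0mx.
case: q sq => // q sq; rewrite big_ord_recl /=; congr (_ + _).
by rewrite -(IH q).
Qed.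

Lemma flat_mxcol p q (B : arr p q) (v : 'I_q -> cV) :
  flat B *m (\mxcol_(j < q) v j) = \mxcol_(i < p) (\sum_j B i j *m v j).
Proof. exact: mul_mxblock_mxrow. Qed.

Lemma flat_barray p q rows s : (size s <= q)%N ->
  flat (barray p q rows) *m bvec q s = bvec p [seq bdot r s | r <- rows].
Proof.
move=> sq; rewrite flat_mxcol; apply: eq_mxcol => i.
transitivity (bdot (nth [::] rows i) s).
  by rewrite -(bdotE _ sq); apply: eq_bigr => j _; rewrite mxE.
have [ir|ri] := ltnP i (size rows); first by rewrite (nth_map [::]).
by rewrite !nth_default ?size_map.
Qed.

Lemma flat_row_barray q r s : (size s <= q)%N ->
  flat_row (barray 1 q [:: r]) *m bvec q s = bdot r s.
Proof.
move=> sq; rewrite /flat_row /bvec mul_mxrow_mxcol -(bdotE _ sq).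
by apply: eq_bigr => j _; rewrite mxE.
Qed.

Lemma bdiag_bvec p ds s :
  bdiag p ds *m bvec p s = \mxcol_(i < p) (nth 0 ds i *m nth 0 s i).
Proof. exact: mul_mxdiag_mxcol. Qed.

Lemma tr_bvec_mul p s (u : 'I_p -> cV) :
  ((bvec p s)^T *m \mxcol_(i < p) u i) 0 0 = \sum_(i < p) ((nth 0 s i)^T *m u i) 0 0.
Proof. by rewrite tr_mxcol mul_mxrow_mxcol summxE. Qed.

Fixpoint qdot (ds : seq 'M[R]_n) (s : seq cV) : R :=
  match ds, s with
  | a :: ds', v :: s' => qf a v + qdot ds' s'
  | _, _ => 0
  end.

Lemma qdotE p ds s : (size s <= p)%N ->
  \sum_(i < p) qf (nth 0 ds i) (nth 0 s i) = qdot ds s.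
Proof.
elim: s p ds => [|v s IH] p [|a ds] /= sp.
- by rewrite big1 // => i _; rewrite nth_nil qf0.
- by rewrite big1 // => i _; rewrite nth_nil qf0r.
- by rewrite big1 // => i _; rewrite nth_nil qf0.
by case: p sp => // p sp; rewrite big_ord_recl /= (IH p).
Qed.

Lemma qf_bdiag p ds s : (size s <= p)%N ->
  qf (bdiag p ds) (bvec p s) = qdot ds s.
Proof.
move=> sp; rewrite /qf /bil -mulmxA bdiag_bvec tr_bvec_mul -(qdotE _ sp).
by apply: eq_bigr => i _; rewrite mulmxA.
Qed.

(** With the two concatenation lemmas below, every zero-padded basic matrix becomes one list of
    rows, to which [flat_barray] applies. *)
Lemma barray0 p q : (0 : arr p q) = barray p q (nseq p (nseq q 0)).
Proof. by apply/matrixP => i j; rewrite !mxE nth_nseq ltn_ord nth_nseq if_same. Qed.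

Lemma row_mx_barray p q1 q2 s t :
  size s = p -> size t = p -> all (fun r => size r == q1) s ->
  row_mx (barray p q1 s) (barray p q2 t)
    = barray p (q1 + q2) [seq x.1 ++ x.2 | x <- zip s t] :> arr p (q1 + q2).
Proof.
move=> sp tp /all_nthP-/(_ [::]) sq; apply/matrixP => i j; rewrite !mxE.
have si : (i < size s)%N by rewrite sp.
rewrite (nth_map ([::], [::])) ?size_zip ?sp ?tp ?minnn //.
rewrite nth_zip /= ?sp ?tp // nth_cat (eqP (sq _ si)).
by case: splitP => k jk; rewrite mxE jk ?addKn.
Qed.

Lemma col_mx_barray p1 p2 q s t : size s = p1 ->
  col_mx (barray p1 q s) (barray p2 q t)
    = barray (p1 + p2) q (s ++ t) :> arr (p1 + p2) q.
Proof.
move=> sp; apply/matrixP => i j; rewrite !mxE nth_cat sp.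
by case: splitP => k jk; rewrite mxE jk ?addKn.
Qed.

Lemma flat_col1 q r s : size s = q ->
  flat (col_mx (barray 1 q [:: r]) 1%:M) *m bvec q s = bvec (1 + q) (bdot r s :: s).
Proof.
move=> sq; rewrite flat_mxcol; apply: eq_mxcol => i.
case: (split_ordP i) => k ->; rewrite ?lshift0 /=.
  rewrite ord1 -(@bdotE q r) ?sq //.
  by apply: eq_bigr => j _; rewrite col_mxEu mxE.
rewrite (bigD1 k) //= big1 ?addr0 => [|j jk].
  by rewrite col_mxEd mxE eqxx mul1mx.
by rewrite col_mxEd mxE eq_sym (negPf jk) mul0mx.
Qed.

Lemma bvecD p s t : size s = size t ->
  bvec p s + bvec p t = bvec p [seq x.1 + x.2 | x <- zip s t].
Proof.
move=> st; rewrite -mxcolD; apply: eq_mxcol => i.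
have [it|ti] := ltnP i (size t).
  by rewrite (nth_map (0, 0)) ?size_zip ?st ?minnn // nth_zip.
by rewrite !nth_default ?addr0 ?size_map ?size_zip ?st ?minnn.
Qed.

Lemma addcv0 (v : cV) : v + 0 = v. Proof. exact: addr0. Qed.

End BlockVectors.

Arguments bdot : simpl never.

(** * Summation inequalities *)

Section Wirtinger.
Variables (R : realType) (n : nat) (Z : 'M[R]_n).
Hypothesis pZ : posdefmx Z.
Implicit Types (y : nat -> 'cV[R]_n).
Local Notation cV := ('cV[R]_n).

(** Expand the nonnegative sum of [qf Z (e i - (a + c i *: b))]; each induction step adds one such
    term. The vectors [a] and [b] are free, to be optimized by the caller. *)
Lemma bessel_affine (e : nat -> cV) (c : nat -> R) (a b : cV) N :
  2 * bil Z (\sum_(i < N) e i) a + 2 * bil Z (\sum_(i < N) c i *: e i) b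
    - N%:R * qf Z a - 2 * (\sum_(i < N) c i) * bil Z a b
    - (\sum_(i < N) c i ^+ 2) * qf Z b
  <= \sum_(i < N) qf Z (e i).
Proof.
have [sZ _] := pZ.
elim: N => [|N IH]; first by rewrite !big_ord0 !bil0l; lra.
rewrite !big_ord_recr /= -natr1 !bilDl !bilZl.
have := posdef_qf_ge0 (e N + (- 1) *: (a + c N *: b)) pZ.
rewrite !qf_add // /qf !(bilZl, bilZr, bilDl, bilDr) -!/(qf _ _).
rewrite (bil_sym b a sZ) in IH *.
move: IH; nra.
Qed.

Lemma sum_arith (K : R) M :
  \sum_(i < M) (K - 2 * i%:R) = K * M%:R - M%:R * (M%:R - 1).
Proof.
elim: M => [|M IH]; first by rewrite big_ord0; ring.
by rewrite big_ord_recr /= IH -natr1; ring.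
Qed.

Lemma sum_arith_sqr (K : R) M :
  \sum_(i < M) (K - 2 * i%:R) ^+ 2
    = K ^+ 2 * M%:R - 2 * K * M%:R * (M%:R - 1)
      + 2 / 3 * M%:R * (M%:R - 1) * (2 * M%:R - 1).
Proof.
elim: M => [|M IH]; first by rewrite big_ord0; field.
by rewrite big_ord_recr /= IH -natr1; field.
Qed.

(** Summation by parts: the weights drop by 2 at each step, so the interior terms add up to twice
    the plain sum, whose term at index 0 is compensated in the coefficient [K + 2]. *)
Lemma sum_arith_diff y (K : R) M :
  \sum_(i < M) (K - 2 * i%:R) *: (y i - y i.+1)
    = (K + 2) *: y 0%N - (K - 2 * M%:R + 2) *: y M - 2 *: \sum_(i < M) y i.
Proof.
elim: M => [|M IH].
  by rewrite !big_ord0; apply/matrixP => i j; rewrite !mxE; ring.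
rewrite !big_ord_recr /= IH -natr1; set s := \sum_(_ < _) _.
by apply/matrixP => i j; rewrite !mxE; ring.
Qed.

Lemma sum_diff y N : \sum_(i < N) (y i - y i.+1) = y 0%N - y N.
Proof.
elim: N => [|N IH]; first by rewrite big_ord0 subrr.
by rewrite big_ord_recr /= IH addrA subrK.
Qed.

(* Bessel's inequality for the differences [y_i - y_(i+1)] against the constants
   and the centred linear weights [N - 1 - 2i], whose squares add up to
   [N (N^2 - 1) / 3]. *)
Lemma wirtinger_sum y (v : cV) N :
  (N.+1%:R : R) *: v = \sum_(i < N.+1) y i ->
  qf Z (y 0%N - y N) + 3 * gamma R N * qf Z (y 0%N + y N - 2 *: v)
  <= N%:R * \sum_(i < N) qf Z (y i - y i.+1).
Proof.
(* With one or two points the mean is the average of the end points, so the second vector is zero.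
   From three points on, [M - 1] below is positive and can be divided by. *)
case: N => [|[|N]] Nv.
- move: Nv; rewrite big_ord1 scale1r => ->; rewrite subrr.
  have -> : y 0%N + y 0%N - 2 *: y 0%N = 0.
    by apply/matrixP => i j; rewrite !mxE; ring.
  by rewrite qf0r; lra.
- have -> : y 0%N + y 1%N - 2 *: v = 0.
    by rewrite Nv !big_ord_recr big_ord0 /= add0r subrr.
  by rewrite qf0r big_ord1; lra.
rewrite /gamma /=; set M := N.+2; set z0 := y 0%N - y M.
set z1 := _ - 2 *: v; set S := \sum_(i < M) _.
have N0 : 0 <= N%:R :> R by rewrite ler0n.
have ME : M%:R = N%:R + 2 :> R by rewrite /M -!natr1; ring.
(* The two vectors are the optimal coefficients: inner product with the weight over its squared
   norm. These are [z0] over M, and (M + 1) [z1] over M (M^2 - 1) / 3. The second one produces the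
   factor 3 (M + 1) / (M - 1), that is [3 * gamma R M]. *)
have := bessel_affine (fun i => y i - y i.+1) (fun i => M%:R - 1 - 2 * i%:R)
  (M%:R^-1 *: z0) ((3 / (M%:R * (M%:R - 1))) *: z1) M.
rewrite sum_diff sum_arith sum_arith_sqr sum_arith_diff -/z0 -/S.
have -> : (M%:R - 1 + 2) *: y 0%N - (M%:R - 1 - 2 * M%:R + 2) *: y M
    - 2 *: \sum_(i < M) y i = (M%:R + 1) *: z1.
  apply/matrixP => i j; move/matrixP/(_ i j): Nv.
  by rewrite big_ord_recr /= -natr1 /z1 -/M !mxE; lra.
rewrite /qf !(bilZl, bilZr) -!/(qf _ _) => H.
have M0 : 0 < M%:R :> R by rewrite ltr0n.
rewrite -ler_pdivrMl //; apply: le_trans H; rewrite le_eqVlt; apply/orP; left.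
apply/eqP; rewrite ME; set q0 := qf Z z0; set q1 := qf Z z1; set b := bil _ _ _.
by field; rewrite ?lt0r_neq0 //; lra.
Qed.

End Wirtinger.

(* Park's reciprocally convex bound, in product form: [N1 + N2] plays the role of
   the interval length and vanishing weights are allowed. *)
Lemma reciprocally_convex (R : realType) m (Z X : 'M[R]_m) (a b : 'cV[R]_m)
    (N1 N2 s1 s2 : R) :
  posdefmx (block_mx Z X X^T Z) -> 0 <= N1 -> 0 <= N2 -> 0 <= s1 -> 0 <= s2 ->
  qf Z a <= N1 * s1 -> qf Z b <= N2 * s2 ->
  (N1 = 0 -> a = 0) -> (N2 = 0 -> b = 0) ->
  qf (block_mx Z X X^T Z) (col_mx a b) <= (N1 + N2) * (s1 + s2).
Proof.
move=> pPsi N1_ge0 N2_ge0 s1_ge0 s2_ge0 ha hb a0 b0.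
have E u v : qf (block_mx Z X X^T Z) (col_mx u v)
    = qf Z u + 2 * bil X u v + qf Z v.
  rewrite /qf /bil tr_col_mx mul_row_block mul_row_col !mulmxDl.
  have mxD (C D : 'M[R]_1) : (C + D) 0 0 = C 0 0 + D 0 0 by rewrite mxE.
  rewrite !mxD; have := bil_tr X v u; rewrite /bil => ->; ring.
rewrite E.
have [N10|N1n0] := eqVneq N1 0.
  rewrite (a0 N10) qf0r bil0l N10; apply: le_trans (_ : N2 * s2 <= _); nra.
have [N20|N2n0] := eqVneq N2 0.
  rewrite (b0 N20) qf0r bil0r N20; apply: le_trans (_ : N1 * s1 <= _); nra.
have p1 : 0 < N1 by rewrite lt0r N1n0.
have p2 : 0 < N2 by rewrite lt0r N2n0.
(* At this vector positivity bounds [N1 * N2] times the cross term by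
   [N2 ^+ 2 * qf Z a + N1 ^+ 2 * qf Z b]. Adding the diagonal terms gives both forms the common
   factor [N1 + N2]. *)
have := posdef_qf_ge0 (col_mx (N2 *: a) (- N1 *: b)) pPsi.
rewrite E /qf !(bilZl, bilZr) -!/(qf _ _) => H.
have {}H : 2 * bil X a b * (N1 * N2) <= N2 ^+ 2 * qf Z a + N1 ^+ 2 * qf Z b.
  by lra.
rewrite -(ler_pM2r (mulr_gt0 p1 p2)).
have h1 : N2 * (N1 + N2) * qf Z a <= N2 * (N1 + N2) * (N1 * s1).
  by rewrite ler_wpM2l // mulr_ge0 ?addr_ge0.
have h2 : N1 * (N1 + N2) * qf Z b <= N1 * (N1 + N2) * (N2 * s2).
  by rewrite ler_wpM2l // mulr_ge0 ?addr_ge0.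
lra.
Qed.

(** * The Lyapunov-Krasovskii functionals *)

Lemma sum_segment (V : nmodType) N a b (F : nat -> V) : (b <= N)%N ->
  \sum_(i < N) (if (a <= i < b)%N then F i else 0) = \sum_(a <= i < b) F i.
Proof.
move=> bN; rewrite -(big_mkord xpredT (fun i => if (a <= i < b)%N then F i else 0)).
rewrite -big_mkcond [RHS](big_nat_widen _ _ N) // [RHS](big_nat_widenl _ 0) //=.
by apply: eq_bigl => i; rewrite andbC.
Qed.

Section Segments.
Variables (R : realType) (n : nat).
Local Notation cV := ('cV[R]_n).
Implicit Types (y : nat -> cV) (Q Z : 'M[R]_n).

Definition cshift (x : cV) y : nat -> cV :=
  fun i => if i is i'.+1 then y i' else x.

(* [(b - a) * #{r in [a, b) | s <= r}], the number of times [s] is hit by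
   the double sum of the Lyapunov functional. *)
Definition weight (a b s : nat) : R := ((b - a) * (b - maxn a s))%N%:R.

Definition qseg a b Q y : R := \sum_(a <= i < b) qf Q (y i.+1).

Definition zseg N a b Z y : R :=
  \sum_(s < N) weight a b s * qf Z (y s - y s.+1).

Lemma weight_ge0 a b s : 0 <= weight a b s. Proof. exact: ler0n. Qed.

Lemma weight_lo a b s : (a <= b)%N -> (s <= a)%N ->
  weight a b s = (b%:R - a%:R) ^+ 2.
Proof. by move=> ab sa; rewrite /weight (maxn_idPl sa) natrM natrB. Qed.

Lemma weight_mid a b s : (a <= s)%N -> (s <= b)%N ->
  weight a b s = (b%:R - a%:R) * (b%:R - s%:R).
Proof.
move=> sa sb; rewrite /weight (maxn_idPr sa) natrM !natrB //.
exact: leq_trans sb.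
Qed.

Lemma weight_out a b s : (b <= s)%N -> weight a b s = 0.
Proof.
by move=> bs; rewrite /weight (eqP (_ : b - maxn a s == 0)%N) ?muln0 //; lia.
Qed.

Lemma weightS a b s : (a <= b)%N ->
  weight a b s - weight a b s.+1 = if (a <= s < b)%N then b%:R - a%:R else 0.
Proof.
move=> ab; case: ifP => [/andP[sa sb]|nab].
  by rewrite (weight_mid sa (ltnW sb)) (weight_mid (leqW sa) sb) -natr1; ring.
have [sa|sa] := ltnP s a; first by rewrite !weight_lo ?subrr // ltnW.
by rewrite !weight_out ?subrr //; lia.
Qed.

Lemma qseg_ge0 a b Q y : posdefmx Q -> 0 <= qseg a b Q y.
Proof. by move=> pQ; apply: sumr_ge0 => i _; exact: posdef_qf_ge0. Qed.

Lemma zseg_ge0 N a b Z y : posdefmx Z -> 0 <= zseg N a b Z y.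
Proof.
move=> pZ; apply: sumr_ge0 => i _.
by rewrite mulr_ge0 ?weight_ge0 ?posdef_qf_ge0.
Qed.

Lemma qseg_shift a b Q x y : (a <= b)%N ->
  qseg a b Q (cshift x y) - qseg a b Q y = qf Q (y a) - qf Q (y b).
Proof.
move=> ab; rewrite /qseg -sumrB /=.
have /= := telescope_sumr (fun i => - qf Q (y i)) ab.
rewrite opprK [- _ + _]addrC => <-.
by apply: eq_bigr => i _; rewrite opprK addrC.
Qed.

(** The shift moves each old difference from index s to s + 1, so it changes weight by [weightS],
    which lives on [a, b). The new difference [x - y 0%N] enters with the full weight of index 0. *)
Lemma zseg_shift N a b Z x y : (a <= b)%N -> (b <= N)%N ->
  zseg N a b Z (cshift x y) - zseg N a b Z y
  = (b%:R - a%:R) ^+ 2 * qf Z (x - y 0%N)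
    - (b%:R - a%:R) * \sum_(a <= s < b) qf Z (y s - y s.+1).
Proof.
move=> ab bN; pose g s := qf Z (y s - y s.+1).
have -> : zseg N a b Z (cshift x y)
    = weight a b 0 * qf Z (x - y 0%N) + \sum_(s < N) weight a b s.+1 * g s.
  (* The added index [N] has weight 0 because [b <= N]; it makes room for the change of index. *)
  transitivity (\sum_(s < N.+1) weight a b s *
      qf Z (cshift x y s - cshift x y s.+1)).
    by rewrite big_ord_recr /= weight_out ?mul0r ?addr0.
  by rewrite big_ord_recl.
rewrite weight_lo // -addrA -sumrB; congr (_ + _).
rewrite -(sum_segment _ _ bN) mulr_sumr -sumrN; apply: eq_bigr => s _.
rewrite -mulrBl -opprB mulNr weightS //.
by case: ifP => _; rewrite ?mul0r ?mulr0.
Qed.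

Lemma qf_mxblock p (T : nat -> nat -> 'M[R]_n) y :
  qf (\mxblock_(i < p, k < p) T i k) (\mxcol_(i < p) y i)
  = \sum_(i < p) \sum_(k < p) bil (T i k) (y i) (y k).
Proof.
rewrite /qf /bil -mulmxA mul_mxblock_mxrow tr_mxcol mul_mxrow_mxcol summxE.
apply: eq_bigr => i _; rewrite mulmx_sumr summxE.
by apply: eq_bigr => k _; rewrite mulmxA.
Qed.

Definition tridiag (D U : nat -> 'M[R]_n) i k : 'M[R]_n :=
  if i == k then D i else if k == i.+1 then U k
  else if i == k.+1 then (U i)^T else 0.

Lemma sum_tridiag D U y N :
  \sum_(i < N.+1) \sum_(k < N.+1) bil (tridiag D U i k) (y i) (y k)
  = \sum_(i < N.+1) qf (D i) (y i)
    + \sum_(i < N) 2 * bil (U i.+1) (y i) (y i.+1).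
Proof.
elim: N => [|N IH].
  by rewrite !big_ord1 big_ord0 addr0 /tridiag eqxx.
have last_term (F : nat -> R) : (forall i, (i < N)%N -> F i = 0) ->
    \sum_(i < N.+1) F i = F N.
  by move=> F0; rewrite big_ord_recr /= big1 ?add0r //= => i _; rewrite F0.
rewrite big_ord_recr /=; under eq_bigr do rewrite big_ord_recr /=.
rewrite big_split /= IH [X in _ + X = _]big_ord_recr /=.
rewrite (last_term (fun i => bil (tridiag D U i N.+1) (y i) (y N.+1))); last first.
  move=> i iN; rewrite /tridiag.
  by do 3![case: ifP => [/eqP|_]; first by lia]; rewrite bil0.
rewrite (last_term (fun k => bil (tridiag D U N.+1 k) (y N.+1) (y k))); last first.
  move=> i iN; rewrite /tridiag.
  by do 3![case: ifP => [/eqP|_]; first by lia]; rewrite bil0.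
rewrite [X in _ = X + _]big_ord_recr [X in _ = _ + X]big_ord_recr /=.
rewrite /tridiag !eqxx.
have -> : (N == N.+1) = false by lia.
have -> : (N.+1 == N) = false by lia.
have -> : (N == N.+2) = false by lia.
by rewrite bil_tr /qf; ring.
Qed.

(** The vector [y i] occurs in two consecutive differences; this is the weight of the earlier one,
    which does not exist for [i = 0]. *)
Definition weight_pred a b i : R := if i is i'.+1 then weight a b i' else 0.

Lemma zseg_expand N a b Z y : posdefmx Z -> (b <= N)%N ->
  \sum_(i < N.+1) (weight a b i + weight_pred a b i) * qf Z (y i)
  - \sum_(i < N) 2 * weight a b i * bil Z (y i) (y i.+1) = zseg N a b Z y.
Proof.
move=> [sZ _] bN; rewrite /zseg.
(* With this boundary term the identity holds for every [N], hence by induction; the term vanishes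
   as soon as [b <= N]. *)
transitivity (\sum_(s < N) weight a b s * qf Z (y s - y s.+1)
    + weight a b N * qf Z (y N)); last by rewrite weight_out ?mul0r ?addr0.
elim: N {bN} => [|N IH]; first by rewrite big_ord1 !big_ord0 /=; ring.
rewrite !big_ord_recr /=.
have -> : qf Z (y N - y N.+1)
    = qf Z (y N) - 2 * bil Z (y N) (y N.+1) + qf Z (y N.+1).
  by rewrite qf_add // /qf !(bilNl, bilNr); ring.
by rewrite big_ord_recr /= in IH; lra.
Qed.

End Segments.

Opaque weight.

(** * The matrices [SOne] and [STwo] as functionals of the window *)

Section Functionals.
Variables (R : realType) (n dm dn dM : nat).
Hypotheses (dm_dn : (dm <= dn)%N) (dn_dM : (dn <= dM)%N).
Variables (P1 : 'M[R]_(\sum_(i < 4) n)) (P2 : 'M[R]_(\sum_(i < 3) n)).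
Variables (Q1 Q2 Z1 Z2 : mode -> 'M[R]_n) (Q3 Z3 : 'M[R]_n).
Hypotheses (Z1_pos : forall j, posdefmx (Z1 j)) (Z2_pos : forall j, posdefmx (Z2 j)).
Hypothesis Z3_pos : posdefmx Z3.

Local Notation lo j := (dlo dm dn j).
Local Notation hi j := (dhi dn dM j).

Lemma dlo_le_dhi j : (lo j <= hi j)%N. Proof. by case: j. Qed.

(** The coefficients of [calH] are pairs of consecutive weights in closed form: for instance m (2m -
    2i + 1) = m (m - i) + m (m - i + 1). The superdiagonal ones are a single weight with a minus
    sign, from the cross term of a difference. *)
Definition calH_diag j i : 'M[R]_n :=
  (if i == 0%N then 0 else if (i <= lo j)%N then Q1 j else Q2 j)
  + (weight R 0 (lo j) i + weight_pred R 0 (lo j) i) *: Z1 j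
  + (weight R (lo j) (hi j) i + weight_pred R (lo j) (hi j) i) *: Z2 j.

Definition calH_super j i : 'M[R]_n :=
  - (weight_pred R 0 (lo j) i *: Z1 j)
  - weight_pred R (lo j) (hi j) i *: Z2 j.

Lemma btridiagE m T0 (Ta Tb Tc Td D U : nat -> 'M[R]_n) i k :
  D 0%N = T0 ->
  (forall r, (r < m)%N -> (r < maxn i k)%N -> D r.+1 = Ta r.+1 /\ U r.+1 = Tb r.+1) ->
  (forall r, (m <= r < maxn i k)%N ->
     D r.+1 = Tc (r.+1 - m)%N /\ U r.+1 = Td (r.+1 - m)%N) ->
  btridiag m T0 Ta Tb Tc Td i k = tridiag D U i k.
Proof.
move=> D0 lt_m ge_m; rewrite /btridiag /tridiag.
have [ik|] := eqVneq i k.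
  subst k; case: i lt_m ge_m => [|r] lt_m ge_m //=.
  rewrite maxnn in lt_m ge_m; case: ltnP => rm; first by rewrite (lt_m _ rm _).1.
  by rewrite (ge_m r _).1 // rm /=.
move=> _; have [ki|] := eqVneq k i.+1.
  subst k; case: ltnP => rm; first by rewrite (lt_m _ rm _).2 //; lia.
  by rewrite (ge_m i _).2 // rm /=; lia.
move=> _; have [ki|//] := eqVneq i k.+1.
subst i; case: ltnP => rm; first by rewrite (lt_m _ rm _).2 //; lia.
by rewrite (ge_m k _).2 // rm /=; lia.
Qed.

(** The range matters: past [hi j] the truncated subtraction makes the weights 0, while the affine
    coefficients of [calH] can become nonzero with the wrong sign. *)
Lemma calH_tridiag j i k : (i <= hi j)%N -> (k <= hi j)%N ->
  calH dm dn dM Q1 Q2 Z1 Z2 j i k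
  = tridiag (calH_diag j) (calH_super j) i k.
Proof.
move=> ih kh; have lh := dlo_le_dhi j.
have ikh : (maxn i k <= hi j)%N by rewrite geq_max ih.
rewrite /calH /dDelta natrB // /calH_diag /calH_super.
move: (lo j) (hi j) lh ikh {ih kh} => m h lh ikh.
apply: btridiagE => [|r rm _|r /andP[mr rik]] /=.
- rewrite (@weight_mid R 0 m 0) // (@weight_lo R m h 0) //.
  by apply/matrixP => a b; rewrite !mxE; ring.
- have mh := leq_trans rm lh; rewrite rm.
  rewrite (weight_mid R (leq0n r.+1) rm) (weight_mid R (leq0n r) (ltnW rm)).
  rewrite (weight_lo R lh rm) (weight_lo R lh (ltnW rm)) -natr1.
  by split; apply/matrixP => a b; rewrite !mxE; ring.
- have rh : (r < h)%N by exact: leq_trans ikh.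
  rewrite ltnNge mr /= (weight_out R 0 (leqW mr)) (weight_out R 0 mr).
  rewrite (weight_mid R (leqW mr) rh) (weight_mid R mr (ltnW rh)).
  rewrite (natrB _ (leqW mr)) -natr1.
  by split; apply/matrixP => a b; rewrite !mxE; ring.
Qed.

Lemma calHa_tridiag i k : (i <= dM)%N -> (k <= dM)%N ->
  calHa dn dM Z3 i k
  = tridiag (fun r => (weight R dn dM r + weight_pred R dn dM r) *: Z3)
      (fun r => - (weight_pred R dn dM r *: Z3)) i k.
Proof.
move=> ih kh; have ikh : (maxn i k <= dM)%N by rewrite geq_max ih.
rewrite /calHa /dDeltaM /= natrB //.
apply: btridiagE => [|r rm _|r /andP[mr rik]] /=.
- rewrite (@weight_lo R dn dM 0) //.
  by apply/matrixP => a b; rewrite !mxE; ring.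
- rewrite (weight_lo R dn_dM rm) (weight_lo R dn_dM (ltnW rm)).
  by split; apply/matrixP => a b; rewrite !mxE; ring.
- have rh : (r < dM)%N by exact: leq_trans ikh.
  rewrite (weight_mid R (leqW mr) rh) (weight_mid R mr (ltnW rh)).
  rewrite (natrB _ (leqW mr)) -natr1.
  by split; apply/matrixP => a b; rewrite !mxE; ring.
Qed.

Local Notation ybar y := (\mxcol_(i < dM.+1) y i).

Lemma sum_zseg2 a1 b1 a2 b2 (Y1 Y2 : 'M[R]_n) (Q : nat -> 'M[R]_n)
    (y : nat -> 'cV[R]_n) :
  posdefmx Y1 -> posdefmx Y2 -> (b1 <= dM)%N -> (b2 <= dM)%N -> Q 0%N = 0 ->
  \sum_(i < dM.+1) \sum_(k < dM.+1)
    bil (tridiag (fun r => Q r + (weight R a1 b1 r + weight_pred R a1 b1 r) *: Y1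
                     + (weight R a2 b2 r + weight_pred R a2 b2 r) *: Y2)
       (fun r => - (weight_pred R a1 b1 r *: Y1) - weight_pred R a2 b2 r *: Y2) i k)
       (y i) (y k)
  = \sum_(0 <= i < dM) qf (Q i.+1) (y i.+1)
    + zseg dM a1 b1 Y1 y + zseg dM a2 b2 Y2 y.
Proof.
move=> pY1 pY2 b1M b2M Q0; rewrite sum_tridiag /=.
rewrite -(zseg_expand a1 y pY1 b1M) -(zseg_expand a2 y pY2 b2M).
under eq_bigr do rewrite !qfD !qfZ.
under [X in _ + X = _]eq_bigr do rewrite bilD !bilN !bilZ mulrDr !mulrN !mulrA.
rewrite !big_split /= !sumrN big_mkord.
rewrite [\sum_(i < dM.+1) qf (Q i) _]big_ord_recl Q0 qf0 /=.
ring.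
Qed.

Lemma sum_indicator_mul a b (y : nat -> 'cV[R]_n) : (b <= dM)%N ->
  \sum_(i < dM.+1) (if (a < i <= b)%N then 1 else 0 : 'M[R]_n) *m y i
  = \sum_(a <= i < b) y i.+1.
Proof.
move=> bM; rewrite big_ord_recl /= mul0mx add0r -(sum_segment _ _ bM).
by apply: eq_bigr => i _ /=; case: ifP => _; rewrite ?mul1mx ?mul0mx.
Qed.

Lemma W5One_ybar (y : nat -> 'cV[R]_n) :
  W5One R n dm dn dM *m ybar y
  = bvec 4 [:: y 0%N; \sum_(0 <= i < dm) y i.+1;
               \sum_(dm <= i < dn) y i.+1; \sum_(dn <= i < dM) y i.+1].
Proof.
rewrite mul_mxblock_mxrow; apply: eq_mxcol => r.
case: r => -[|[|[|[|//]]]] ? /=; rewrite ?sum_indicator_mul // ?(leq_trans dm_dn) //.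
rewrite big_ord_recl big1 /= ?addr0 ?mul1mx // => i _.
by rewrite mul0mx.
Qed.

Lemma W5Two_ybar (y : nat -> 'cV[R]_n) :
  W5Two R n dm dn dM *m ybar y
  = bvec 3 [:: y 0%N; \sum_(0 <= i < dn) y i.+1; \sum_(dn <= i < dM) y i.+1].
Proof.
rewrite mul_mxblock_mxrow; apply: eq_mxcol => r.
case: r => -[|[|[|//]]] ? /=; rewrite ?sum_indicator_mul //.
rewrite big_ord_recl big1 /= ?addr0 ?mul1mx // => i _.
by rewrite mul0mx.
Qed.

Lemma eq_tridiag (D U D' U' : nat -> 'M[R]_n) i k :
  D i = D' i -> (k = i.+1 -> U k = U' k) -> (i = k.+1 -> U i = U' i) ->
  tridiag D U i k = tridiag D' U' i k.
Proof.
move=> DD' Uk Ui; rewrite /tridiag.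
have [_|_] := eqVneq i k; first exact: DD'.
have [/Uk//|_] := eqVneq k i.+1.
by have [/Ui->|] := eqVneq i k.+1.
Qed.

Lemma qf_calHa (y : nat -> 'cV[R]_n) :
  qf (\mxblock_(i < dM.+1, k < dM.+1) calHa dn dM Z3 i k) (ybar y)
  = zseg dM dn dM Z3 y.
Proof.
rewrite (_ : \mxblock_(_, _) _ = \mxblock_(i < dM.+1, k < dM.+1)
    tridiag (fun r => (weight R dn dM r + weight_pred R dn dM r) *: Z3)
      (fun r => - (weight_pred R dn dM r *: Z3)) i k); last first.
  by apply: eq_mxblock => i k; rewrite calHa_tridiag // -ltnS.
rewrite qf_mxblock sum_tridiag /= -(zseg_expand dn y Z3_pos (leqnn dM)).
under eq_bigr do rewrite qfZ; congr (_ + _); rewrite -sumrN.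
by apply: eq_bigr => i _; rewrite bilN bilZ mulrN mulrA.
Qed.

Lemma SOneE (y : nat -> 'cV[R]_n) :
  qf (SOne dm dn dM P1 Q1 Q2 Z1 Z2 Q3 Z3) (ybar y)
  = qf P1 (bvec 4 [:: y 0%N; \sum_(0 <= i < dm) y i.+1;
               \sum_(dm <= i < dn) y i.+1; \sum_(dn <= i < dM) y i.+1])
    + qseg 0 dm (Q1 One) y + qseg dm dn (Q2 One) y + qseg dn dM Q3 y
    + zseg dM 0 dm (Z1 One) y + zseg dM dm dn (Z2 One) y + zseg dM dn dM Z3 y.
Proof.
rewrite /SOne qfD qf_mul W5One_ybar -!addrA; congr (_ + _).
(* Merging the corner blocks [Q3] into one stepwise family gives the whole first summand of
   [calPOne] a single tridiagonal form. *)
pose Q i : 'M[R]_n := if i == 0%N then 0 else if (i <= dm)%N then Q1 One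
  else if (i <= dn)%N then Q2 One else Q3.
have dm_dM := leq_trans dm_dn dn_dM.
rewrite /calPOne qfD qf_calHa.
rewrite (_ : \mxblock_(_, _) _ = \mxblock_(i < dM.+1, k < dM.+1)
  (tridiag (fun r => Q r
       + (weight R 0 dm r + weight_pred R 0 dm r) *: Z1 One
       + (weight R dm dn r + weight_pred R dm dn r) *: Z2 One)
     (fun r => - (weight_pred R 0 dm r *: Z1 One)
               - weight_pred R dm dn r *: Z2 One)) i k); last first.
  apply: eq_mxblock => i k /=; case: ifP => [/andP[i_dn k_dn]|].
    rewrite calH_tridiag //; apply: eq_tridiag => //.
    by rewrite /calH_diag /Q /= i_dn.
  move=> out.
  transitivity (tridiag (fun=> Q3) (fun=> 0) i k).
    by rewrite /tridiag trmx0 !if_same.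
  (* Superdiagonal block r carries the weights of r - 1, so already the coupling of dn with dn + 1,
     which lies outside the leading block, is zero. *)
  have U0 r : (dn < r)%N -> 0 = - (weight_pred R 0 dm r *: Z1 One)
       - weight_pred R dm dn r *: Z2 One.
    case: r => // r; rewrite ltnS => dn_r /=; rewrite (weight_out R 0 (leq_trans dm_dn dn_r)).
    by rewrite (weight_out R dm dn_r) !scale0r subr0 oppr0.
  rewrite /tridiag; case: eqP => [ik|_].
    rewrite -ik andbb in out; move/negbT: out; rewrite -ltnNge => dn_i.
    move: dn_i; rewrite /Q; case: (nat_of_ord i) => // r; rewrite ltnS => dn_r /=.
    have dm_r := leq_trans dm_dn dn_r.
    rewrite (ltnNge r dm) dm_r (ltnNge r dn) dn_r /=.
    rewrite !(weight_out R 0) ?(weight_out R dm) ?leqW //.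
    by rewrite !addr0 !scale0r !addr0.
  case: eqP => [ki|_]; first by apply: U0; lia.
  case: eqP => [ik|//]; rewrite -(U0 i) //; lia.
rewrite qf_mxblock sum_zseg2 //.
rewrite (big_cat_nat (n := dm)) //=.
rewrite [\sum_(dm <= i < dM) _](big_cat_nat (n := dn)) //=.
rewrite /qseg -!addrA; congr (_ + (_ + (_ + _))); apply: eq_big_nat => i ir.
- by rewrite /Q /= (andP ir).2.
- by rewrite /Q /= ltnNge (andP ir).1 (andP ir).2.
- rewrite /Q /= ltnNge (leq_trans dm_dn (andP ir).1).
  by rewrite ltnNge (andP ir).1.
Qed.

Lemma STwoE (y : nat -> 'cV[R]_n) :
  qf (STwo dm dn dM P2 Q1 Q2 Z1 Z2) (ybar y)
  = qf P2 (bvec 3 [:: y 0%N; \sum_(0 <= i < dn) y i.+1;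
               \sum_(dn <= i < dM) y i.+1])
    + qseg 0 dn (Q1 Two) y + qseg dn dM (Q2 Two) y
    + zseg dM 0 dn (Z1 Two) y + zseg dM dn dM (Z2 Two) y.
Proof.
rewrite /STwo qfD qf_mul W5Two_ybar -!addrA; congr (_ + _).
rewrite /calPTwo (_ : \mxblock_(_, _) _ = \mxblock_(i < dM.+1, k < dM.+1)
    tridiag (calH_diag Two) (calH_super Two) i k); last first.
  by apply: eq_mxblock => i k; rewrite calH_tridiag // -ltnS.
rewrite qf_mxblock sum_zseg2 //=.
rewrite (big_cat_nat (n := dn)) //=.
rewrite /qseg -!addrA; congr (_ + (_ + _)); apply: eq_big_nat => i ir.
- by rewrite (andP ir).2.
- by rewrite ltnNge (andP ir).1.
Qed.

End Functionals.

(** * Means and summation bounds on segments of the window *)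

Section SegmentBounds.
Variables (R : realType) (n : nat).
Local Notation cV := ('cV[R]_n).
Implicit Types (y : nat -> cV) (Z : 'M[R]_n).

Definition zeta y a b (v : cV) : 'cV[R]_(\sum_(i < 2) n) :=
  bvec 2 [:: y a - y b; y a + y b - 2 *: v].

(** Both ends are counted, so adjacent segments share a point and the mean over a one-point segment
    still makes sense. *)
Definition is_mean y a b (v : cV) : Prop :=
  ((b - a).+1%:R : R) *: v = \sum_(a <= i < b.+1) y i.

Lemma gamma_ge1 d : 1 <= gamma R d.+1.
Proof.
rewrite /gamma; case: eqP => // /eqP d1.
have d2 : 2 <= d.+1%:R :> R by rewrite ler_nat; lia.
by rewrite ler_pdivlMr; lra.
Qed.

Lemma wirtinger_segment Z y a b v : posdefmx Z -> (a <= b)%N ->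
  is_mean y a b v ->
  qf (bdiag 2 [:: Z; (3 * gamma R (b - a)) *: Z]) (zeta y a b v)
  <= (b%:R - a%:R) * \sum_(a <= s < b) qf Z (y s - y s.+1).
Proof.
move=> pZ ab; have [N ->] : exists N, b = (a + N)%N.
  by exists (b - a)%N; rewrite subnKC.
rewrite /is_mean /zeta addKn -addnS.
have shift (V : nmodType) (F : nat -> V) M :
    \sum_(a <= i < a + M) F i = \sum_(i < M) F (i + a)%N.
  by rewrite -[X in \sum_(X <= _ < _) _]add0n big_addn addKn big_mkord.
rewrite !shift => mv.
rewrite qf_bdiag //= addr0 qfZ natrD [_ + N%:R]addrC addrK.
have := wirtinger_sum pZ (y := fun i => y (i + a)%N) mv.
by rewrite add0n [(N + a)%N]addnC.
Qed.

Lemma is_mean0 y a v : is_mean y a a v -> v = y a.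
Proof. by rewrite /is_mean subnn scale1r big_nat1. Qed.

Lemma zeta0 y a v : is_mean y a a v -> zeta y a a v = 0.
Proof.
move=> /is_mean0 ->; rewrite /zeta subrr.
have -> : y a + y a - 2 *: y a = 0.
  by apply/matrixP => i j; rewrite !mxE; ring.
by rewrite /bvec -[RHS]mxcol0; apply: eq_mxcol => -[[|[|//]]].
Qed.

(** Since gamma is at least 1 at positive lengths, 3 may replace 3 gamma. This keeps the matrix
    independent of the length, which varies with the delay in [Psiz]. *)
Lemma wirtinger_segment3 Z y a b v : posdefmx Z -> (a <= b)%N ->
  is_mean y a b v ->
  qf (bdiag 2 [:: Z; 3 *: Z]) (zeta y a b v)
  <= (b%:R - a%:R) * \sum_(a <= s < b) qf Z (y s - y s.+1).
Proof.
(* At length 0 the formula gives gamma = -1, so monotonicity fails there; but then [zeta] is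
   zero. *)
move=> pZ ab mv; have [ba|ba] := leqP b a.
  have ? : a = b by apply/eqP; rewrite eqn_leq ab.
  by subst b; rewrite zeta0 // qf0r subrr mul0r.
apply: le_trans (wirtinger_segment pZ ab mv).
rewrite !qf_bdiag //= !qfZ lerD2l !addr0.
rewrite ler_wpM2r ?posdef_qf_ge0 // ler_peMr ?ler0n //.
by rewrite -(prednK (n := b - a)) ?subn_gt0 // gamma_ge1.
Qed.

(** The delay cuts [a, b] into two segments whose lengths serve as the weights of the reciprocally
    convex bound. They add up to the fixed length b - a, and a segment of length 0 has [zeta] equal
    to 0. *)
Lemma psi_segment Z (X : 'M[R]_(\sum_(i < 2) n)) y a d b v w :
  posdefmx Z ->
  posdefmx (block_mx (bdiag 2 [:: Z; 3 *: Z]) X X^T (bdiag 2 [:: Z; 3 *: Z])) ->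
  (a <= d)%N -> (d <= b)%N -> is_mean y a d v -> is_mean y d b w ->
  qf (block_mx (bdiag 2 [:: Z; 3 *: Z]) X X^T (bdiag 2 [:: Z; 3 *: Z]))
    (col_mx (zeta y d b w) (zeta y a d v))
  <= (b%:R - a%:R) * \sum_(a <= s < b) qf Z (y s - y s.+1).
Proof.
move=> pZ pPsi ad db mv mw.
pose S r t := \sum_(r <= s < t) qf Z (y s - y s.+1).
have S0 r t : 0 <= S r t by apply: sumr_ge0 => s _; exact: posdef_qf_ge0.
have -> : (b%:R - a%:R) * S a b = ((b%:R - d%:R) + (d%:R - a%:R)) * (S d b + S a d).
  by rewrite /S (big_cat_nat (n := d)) //=; ring.
apply: reciprocally_convex => //.
- by rewrite subr_ge0 ler_nat.
- by rewrite subr_ge0 ler_nat.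
- exact: wirtinger_segment3.
- exact: wirtinger_segment3.
- move=> /eqP; rewrite subr_eq0 eqr_nat => /eqP ?; subst b; exact: zeta0.
- move=> /eqP; rewrite subr_eq0 eqr_nat => /eqP ?; subst d; exact: zeta0.
Qed.

(** The sums in the functionals omit one end of each segment, while the means count both. Applied on
    either side of the delay, these coefficients are affine in it: the constant parts appear in
    [W1ab] and [W2ab], the linear ones in [Wd]. *)
Lemma mean_head y a b v : (a <= b)%N -> is_mean y a b v ->
  \sum_(a <= i < b) y i = (b%:R - a%:R + 1 : R) *: v - y b.
Proof.
move=> ab; rewrite /is_mean -natr1 natrB // => ->.
by rewrite big_nat_recr //= addrK.
Qed.

Lemma mean_tail y a b v : (a <= b)%N -> is_mean y a b v ->
  \sum_(a <= i < b) y i.+1 = (b%:R - a%:R + 1 : R) *: v - y a.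
Proof.
move=> ab; rewrite /is_mean -natr1 natrB // => ->.
by rewrite [in RHS]big_ltn ?ltnS // [in RHS]big_add1 /= [y a + _]addrC addrK.
Qed.

(** The same [Wd] corrects both arguments, so the terms quadratic in it cancel. What remains is the
    change of the [P]-term over one step, yet affine in the delay. *)
Lemma qf_Phi1 p q (P : 'M[R]_p) (W1 W2 Wd : 'M[R]_(p, q)) v : P^T = P ->
  qf (Phi1 P W1 W2 Wd) v
  = qf P ((W2 + Wd) *m v) - qf P ((W1 + Wd) *m v).
Proof.
move=> sP; rewrite /Phi1 qfD qfB !qf_mul qf_He [qf (Wd^T *m P *m _) v]/qf bil_mul.
rewrite !mulmxDl !qf_add // mulNmx bilDr bilNr !(bil_sym _ (Wd *m v) sP).
ring.
Qed.

End SegmentBounds.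

(** * Decrease within a mode *)

Section ModeTwo.
Variables (R : realType) (n dm dn dM : nat).
Hypotheses (dm_dn : (dm <= dn)%N) (dn_dM : (dn <= dM)%N).
Variables (P2 : 'M[R]_(\sum_(i < 3) n)) (Q1 Q2 Z1 Z2 : mode -> 'M[R]_n).
Variable X : mode -> 'M[R]_(\sum_(i < 2) n).
Hypothesis P2_pos : posdefmx P2.
Hypotheses (Z1_pos : forall j, posdefmx (Z1 j)) (Z2_pos : forall j, posdefmx (Z2 j)).
Hypothesis Psi_pos : forall j, posdefmx (Psiz Z2 X j).

Variables (y : nat -> 'cV[R]_n) (x v1 v2 v3 : 'cV[R]_n) (d : nat).
Local Notation y' := (cshift x y).
Local Notation ybar y := (\mxcol_(i < dM.+1) y i).

(** [x] will be x(k + 1); [v1], [v2], [v3] are the means over [0, dn], [dn, d] and [d, dM]. *)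
Let xi2 := bvec 8 [:: x; y 0%N; y dn; y d; y dM; v1; v2; v3].

Lemma WsTwo_xi : WsTwo R n *m xi2 = zeta y 0 dn v1.
Proof.
rewrite /WsTwo /Ws /Mbase barray0 row_mx_barray // flat_barray //=.
congr (bvec _ [:: _; _]); rewrite !bdot_simp !addcv0 //.
by rewrite scaleNr addrA.
Qed.

Lemma WPsiTwo_xi :
  WPsiTwo R n *m xi2 = col_mx (zeta y d dM v3) (zeta y dn d v2).
Proof.
rewrite /WPsiTwo mul_col_mx; congr col_mx.
  rewrite /WPsi_up /Mbase barray0 row_mx_barray // flat_barray //=.
  congr (bvec _ [:: _; _]); rewrite !bdot_simp !addcv0 //.
    by rewrite scaleNr addrA.
rewrite /WPsi_dn /Mbase !barray0 !row_mx_barray // flat_barray //=.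
congr (bvec _ [:: _; _]); rewrite !bdot_simp !addcv0 //.
by rewrite scaleNr addrA.
Qed.

Lemma W3Two_xi : W3Two R n *m xi2 = x - y 0%N.
Proof.
by rewrite /W3Two flat_row_barray //= !bdot_simp addcv0.
Qed.

Hypotheses (dn_d : (dn <= d)%N) (d_dM : (d <= dM)%N).
Hypotheses (mean1 : is_mean y 0 dn v1) (mean2 : is_mean y dn d v2).
Hypothesis mean3 : is_mean y d dM v3.

Lemma W2Two_xi : (W2Two R n dm dn dM + WdTwo R n d) *m xi2
  = bvec 3 [:: x; \sum_(0 <= i < dn) y i; \sum_(dn <= i < dM) y i].
Proof.
rewrite mulmxDl /W2Two /W2ab /WdTwo /Wd !barray0 col_mx_barray //.
rewrite !flat_barray //= bvecD //=.
rewrite [\sum_(dn <= i < dM) _](big_cat_nat (n := d)) //=.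
rewrite (mean_head _ mean1) // (mean_head _ mean2) // (mean_head _ mean3) //.
rewrite !bdot_simp.
congr (bvec _ [:: _; _; _]); apply/matrixP => i j; rewrite !mxE; ring.
Qed.

Lemma W1Two_xi : (W1Two R n dm dn dM + WdTwo R n d) *m xi2
  = bvec 3 [:: y 0%N; \sum_(0 <= i < dn) y i.+1; \sum_(dn <= i < dM) y i.+1].
Proof.
rewrite mulmxDl /W1Two /W1ab /WdTwo /Wd !barray0 col_mx_barray //.
rewrite !flat_barray //= bvecD //=.
rewrite [\sum_(dn <= i < dM) _](big_cat_nat (n := d)) //=.
rewrite (mean_tail _ mean1) // (mean_tail _ mean2) // (mean_tail _ mean3) //.
rewrite !bdot_simp.
congr (bvec _ [:: _; _; _]); apply/matrixP => i j; rewrite !mxE; ring.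
Qed.

(** The [P]- and [Q]-terms match exactly, as do the new differences [x - y 0%N]. The only loss is in
    the negative sums of differences: Wirtinger on [0, dn], [psi_segment] on [dn, dM]. *)
Lemma STwo_decrement :
  qf (STwo dm dn dM P2 Q1 Q2 Z1 Z2) (ybar y')
    - qf (STwo dm dn dM P2 Q1 Q2 Z1 Z2) (ybar y)
  <= qf (PhiTwo dm dn dM P2 Q1 Q2 Z1 Z2 X d) xi2.
Proof.
rewrite !STwoE //= /PhiTwo qfD [X in _ <= X + _]qfD qf_Phi1; last by case: P2_pos.
rewrite W2Two_xi W1Two_xi /Phi3Two !qfB !qf_mul WsTwo_xi WPsiTwo_xi W3Two_xi.
rewrite qfD !qfZ /dDelta /= natrB //.
rewrite /calQTwo qf_bdiag //= !(qf0, qfB, qfN).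
have := qseg_shift (Q1 Two) x y (leq0n dn).
have := qseg_shift (Q2 Two) x y dn_dM.
have := zseg_shift (Z1 Two) x y (leq0n dn) dn_dM.
have := zseg_shift (Z2 Two) x y dn_dM (leqnn dM).
have := wirtinger_segment (Z1_pos Two) (leq0n dn) mean1.
rewrite subn0 => h1 h2 h3 h4 h5.
have h6 := psi_segment (Z2_pos Two) (Psi_pos Two) dn_d d_dM mean2 mean3.
rewrite /calZ1 /Psiz /calZ2 /=; lra.
Qed.

End ModeTwo.

Section ModeOne.
Variables (R : realType) (n dm dn dM : nat).
Hypotheses (dm_dn : (dm <= dn)%N) (dn_dM : (dn <= dM)%N).
Variables (P1 : 'M[R]_(\sum_(i < 4) n)).
Variables (Q1 Q2 Z1 Z2 : mode -> 'M[R]_n) (Q3 Z3 : 'M[R]_n).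
Variable X : mode -> 'M[R]_(\sum_(i < 2) n).
Hypothesis P1_pos : posdefmx P1.
Hypotheses (Z1_pos : forall j, posdefmx (Z1 j)) (Z2_pos : forall j, posdefmx (Z2 j)).
Hypotheses (Q3_pos : posdefmx Q3) (Z3_pos : posdefmx Z3).
Hypothesis Psi_pos : forall j, posdefmx (Psiz Z2 X j).

Variables (y : nat -> 'cV[R]_n) (x v1 v2 v3 v4 : 'cV[R]_n) (d : nat).
Local Notation y' := (cshift x y).
Local Notation ybar y := (\mxcol_(i < dM.+1) y i).

(** The last two blocks serve the segment [dn, dM], which the delay does not cut in this mode; [v4]
    is its mean. *)
Let xi1 := bvec 10 [:: x; y 0%N; y dm; y d; y dn; v1; v2; v3; y dM; v4].

Lemma WsOne_xi : WsOne R n *m xi1 = zeta y 0 dm v1.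
Proof.
rewrite /WsOne /Ws /Mbase !barray0 !row_mx_barray // flat_barray //=.
congr (bvec _ [:: _; _]); rewrite !bdot_simp !addcv0 //.
by rewrite scaleNr addrA.
Qed.

Lemma WPsiOne_xi :
  WPsiOne R n *m xi1 = col_mx (zeta y d dn v3) (zeta y dm d v2).
Proof.
rewrite /WPsiOne mul_col_mx; congr col_mx.
  rewrite /WPsi_up /Mbase !barray0 !row_mx_barray // flat_barray //=.
  congr (bvec _ [:: _; _]); rewrite !bdot_simp !addcv0 //.
    by rewrite scaleNr addrA.
rewrite /WPsi_dn /Mbase !barray0 !row_mx_barray // flat_barray //=.
congr (bvec _ [:: _; _]); rewrite !bdot_simp !addcv0 //.
by rewrite scaleNr addrA.
Qed.

Lemma W3One_xi : W3One R n *m xi1 = x - y 0%N.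
Proof.
rewrite /W3One /W3 barray0 row_mx_barray // flat_row_barray //=.
by rewrite !bdot_simp addcv0.
Qed.

Lemma Wz_xi : Wz R n *m xi1 = zeta y dn dM v4.
Proof.
rewrite /Wz flat_barray //=.
congr (bvec _ [:: _; _]); rewrite !bdot_simp !addcv0 //.
by rewrite scaleNr addrA.
Qed.

Hypotheses (dm_d : (dm <= d)%N) (d_dn : (d <= dn)%N).
Hypotheses (mean1 : is_mean y 0 dm v1) (mean2 : is_mean y dm d v2).
Hypotheses (mean3 : is_mean y d dn v3) (mean4 : is_mean y dn dM v4).

Lemma W2One_xi : (W2One R n dm dn dM + WdOne R n d) *m xi1
  = bvec 4 [:: x; \sum_(0 <= i < dm) y i; \sum_(dm <= i < dn) y i;
               \sum_(dn <= i < dM) y i].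
Proof.
rewrite mulmxDl /W2One /W2ab /WdOne /Wd !barray0 col_mx_barray //.
rewrite !row_mx_barray // !col_mx_barray // !flat_barray //= bvecD //=.
rewrite [\sum_(dm <= i < dn) _](big_cat_nat (n := d)) //= (mean_head _ mean1) //.
rewrite (mean_head _ mean2) // (mean_head _ mean3) // (mean_head _ mean4) //.
rewrite /dDeltaM /= natrB //.
rewrite !bdot_simp.
congr (bvec _ [:: _; _; _; _]); apply/matrixP => i j; rewrite !mxE; ring.
Qed.

Lemma W1One_xi : (W1One R n dm dn dM + WdOne R n d) *m xi1
  = bvec 4 [:: y 0%N; \sum_(0 <= i < dm) y i.+1; \sum_(dm <= i < dn) y i.+1;
               \sum_(dn <= i < dM) y i.+1].
Proof.
rewrite mulmxDl /W1One /W1ab /WdOne /Wd !barray0 col_mx_barray //.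
rewrite !row_mx_barray // !col_mx_barray // !flat_barray //= bvecD //=.
rewrite [\sum_(dm <= i < dn) _](big_cat_nat (n := d)) //= (mean_tail _ mean1) //.
rewrite (mean_tail _ mean2) // (mean_tail _ mean3) // (mean_tail _ mean4) //.
rewrite /dDeltaM /= natrB //.
rewrite !bdot_simp.
congr (bvec _ [:: _; _; _; _]); apply/matrixP => i j; rewrite !mxE; ring.
Qed.

(* Only an inequality already for the [Q]-terms: [calQOne] lacks the block
   [- Q3] at [x (k - dM)]. *)
Lemma SOne_decrement :
  qf (SOne dm dn dM P1 Q1 Q2 Z1 Z2 Q3 Z3) (ybar y')
    - qf (SOne dm dn dM P1 Q1 Q2 Z1 Z2 Q3 Z3) (ybar y)
  <= qf (PhiOne dm dn dM P1 Q1 Q2 Z1 Z2 X Q3 Z3 d) xi1.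
Proof.
rewrite !SOneE //= /PhiOne qfD [X in _ <= X + _]qfD qf_Phi1; last by case: P1_pos.
rewrite W2One_xi W1One_xi /Phi3One !qfB !qf_mul.
rewrite WsOne_xi WPsiOne_xi W3One_xi Wz_xi.
rewrite !qfD !qfZ /dDelta /dDeltaM /= !natrB //.
rewrite /calQOne qf_bdiag //= !(qf0, qfB, qfN).
have := qseg_shift (Q1 One) x y (leq0n dm).
have := qseg_shift (Q2 One) x y dm_dn.
have := qseg_shift Q3 x y dn_dM.
have := zseg_shift (Z1 One) x y (leq0n dm) (leq_trans dm_dn dn_dM).
have := zseg_shift (Z2 One) x y dm_dn dn_dM.
have := zseg_shift Z3 x y dn_dM (leqnn dM).
have := wirtinger_segment (Z1_pos One) (leq0n dm) mean1.
rewrite subn0 => h1 h2 h3 h4 h5 h6 h7.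
have h8 := psi_segment (Z2_pos One) (Psi_pos One) dm_d d_dn mean2 mean3.
have h9 := wirtinger_segment3 Z3_pos dn_dM mean4.
have h10 := posdef_qf_ge0 (y dM) Q3_pos.
rewrite /calZ1 /calZ3 /Psiz /calZ2 /=; lra.
Qed.

End ModeOne.

(** * Switching conditions *)

Section StackedBlocks.
Variables (R : realType) (n : nat).
Local Notation cV := ('cV[R]_n).
Implicit Types (y : nat -> cV) (x : cV).

Lemma mxcol_entry p y (s : 'I_(\sum_(i < p) n)) q (r : 'I_n) :
  s = (q * n + r)%N :> nat -> (\mxcol_(i < p) y i) s 0 = y q r 0.
Proof.
move=> s_qr; rewrite mxE.
have n_gt0 : (0 < n)%N by exact: leq_ltn_trans (ltn_ord r).
have s_sig : s = (tagnat.sig1 s * n + tagnat.sig2 s)%N :> nat.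
  rewrite {1}[s : nat]tagnat.rect; congr (_ + _)%N.
  rewrite -(big_ord_widen p (fun=> n)) ?sum_nat_const ?card_ord //.
  exact/ltnW/ltn_ord.
have q1 : tagnat.sig1 s = q :> nat.
  have := congr1 (divn^~ n) (etrans (esym s_sig) s_qr).
  by rewrite /= !divnMDl // !divn_small ?addn0.
have r1 : tagnat.sig2 s = r.
  by apply: val_inj; move: s_sig; rewrite s_qr q1 => /addnI.
by rewrite r1 q1.
Qed.

(** Both stacks list [x], [y 0], [y 1], ... and differ only in how the blocks are grouped: in
    either, scalar entry s is entry s mod n of block s div n. The left grouping comes from [Lperp],
    the right one from [diagS0]. *)
Lemma cast_shift p x y : (0 < n)%N ->
  castmx (esym (addnC (\sum_(i < p) n) n)%N, erefl) (col_mx x (\mxcol_(i < p) y i))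
  = col_mx (\mxcol_(i < p) cshift x y i) (cshift x y p).
Proof.
move=> n_gt0; apply/matrixP => s j; rewrite ord1 castmxE cast_ord_id {j}.
pose q := (s %/ n)%N; pose r := Ordinal (ltn_pmod s n_gt0).
have s_qr : s = (q * n + r)%N :> nat by rewrite /= -divn_eq.
transitivity (cshift x y q r 0).
  set s' := cast_ord _ s; have s's : s = s' :> nat by [].
  case: (split_ordP s') => k kE.
    have ks : s = k :> nat by rewrite s's kE.
    rewrite kE col_mxEu.
    have -> : q = 0%N by rewrite /q ks divn_small.
    by congr (x _ _); apply: val_inj; rewrite /= ks modn_small.
  have ks : s = (n + k)%N :> nat by rewrite s's kE.
  rewrite kE col_mxEd; have q_gt0 : (0 < q)%N by rewrite divn_gt0 // ks leq_addr.
  rewrite -(prednK q_gt0) /=; apply: mxcol_entry.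
  apply: (@addnI n); rewrite -ks s_qr addnA; congr (_ + _)%N.
  by rewrite -mulSn prednK.
case: (split_ordP s) => k ks.
  by rewrite ks col_mxEu; symmetry; apply: mxcol_entry; rewrite -s_qr ks.
have {}ks : s = (p * n + k)%N :> nat by rewrite ks /= sum_nat_const card_ord.
have -> : q = p by rewrite /q ks divnMDl // divn_small ?addn0.
have -> : s = rshift _ k by apply: val_inj; rewrite /= ks sum_nat_const card_ord.
rewrite col_mxEd; congr (_ _ _); apply: val_inj.
by rewrite /= ks modnMDl modn_small.
Qed.

End StackedBlocks.

(** * Uniform decrease constants from strict matrix inequalities *)

Section NegativeDefinite.
Variable R : realType.

Lemma loewner_neg_coord m (M : 'M[R]_m) : M \prec 0 ->
  exists2 c : R, 0 < c & forall (v : 'cV[R]_m) i, qf M v <= - (c * v i 0 ^+ 2).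
Proof.
move=> /posdef_coord[c c0 H]; exists c => // v i.
by have := H v i; rewrite sub0r qfN; lra.
Qed.

(** For a fixed vector the form is affine in the delay, so the end selected by the sign of the slope
    bounds it, and the smaller of the two end constants serves for all delays. *)
Lemma loewner_neg_affine m (M : nat -> 'M[R]_m) lo hi :
  M lo \prec 0 -> M hi \prec 0 ->
  (forall v, exists a b, forall d, qf (M d) v = a + d%:R * b) ->
  exists2 c : R, 0 < c & forall d (v : 'cV[R]_m) i, (lo <= d <= hi)%N ->
    qf (M d) v <= - (c * v i 0 ^+ 2).
Proof.
move=> /loewner_neg_coord[c1 c1_gt0 H1] /loewner_neg_coord[c2 c2_gt0 H2] aff.
exists (Num.min c1 c2); first by rewrite lt_min c1_gt0.
move=> d v i /andP[lo_d d_hi]; have [a [b E]] := aff v.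
have := H1 v i; have := H2 v i; rewrite !E => h2 h1.
have v2 := sqr_ge0 (v i 0).
have m1 : Num.min c1 c2 * v i 0 ^+ 2 <= c1 * v i 0 ^+ 2.
  by rewrite ler_wpM2r // ge_min lexx.
have m2 : Num.min c1 c2 * v i 0 ^+ 2 <= c2 * v i 0 ^+ 2.
  by rewrite ler_wpM2r // ge_min lexx orbT.
have ld : lo%:R <= d%:R :> R by rewrite ler_nat.
have dh : d%:R <= hi%:R :> R by rewrite ler_nat.
by have [b0|b0] := leP 0 b; nra.
Qed.

Lemma uniform_const N (P : nat -> R -> Prop) :
  (forall l c c', c' <= c -> P l c -> P l c') ->
  (forall l, (l < N)%N -> exists2 c, 0 < c & P l c) ->
  exists2 c, 0 < c & forall l, (l < N)%N -> P l c.
Proof.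
move=> Pmono; elim: N => [_|N IH ex]; first by exists 1.
have [|c c0 H] := IH; first by move=> l lN; apply: ex; exact: ltnW.
have [c' c'0 H'] := ex N (ltnSn N).
exists (Num.min c c'); first by rewrite lt_min c0.
move=> l; rewrite ltnS leq_eqVlt => /orP[/eqP->|lN].
  by apply: Pmono H'; rewrite ge_min lexx orbT.
by apply: Pmono (H _ lN); rewrite ge_min lexx.
Qed.

Lemma mxcol_head n p (y : nat -> 'cV[R]_n) (i : 'I_n) :
  (\mxcol_(j < p.+1) y j) (tagnat.Rank ord0 i) 0 = y 0%N i 0.
Proof. by have /matrixP/(_ i 0) := mxcolK (fun j : 'I_p.+1 => y j) ord0; rewrite mxE. Qed.

Lemma bvec_head n p (v : 'cV[R]_n) s (i : 'I_n) :
  bvec p.+1 (v :: s) (tagnat.Rank ord0 i) 0 = v i 0.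
Proof. exact: (mxcol_head p (fun j => nth 0 (v :: s) j)). Qed.

Lemma mean_exists n (y : nat -> 'cV[R]_n) a b : exists v, is_mean y a b v.
Proof.
exists ((b - a).+1%:R^-1 *: \sum_(a <= i < b.+1) y i).
by rewrite /is_mean scalerA divff ?scale1r // pnatr_eq0.
Qed.

Lemma qf_Phi1_affine p q (P : 'M[R]_p) (W1 W2 Wd : 'M[R]_(p, q)) a (W : 'M[R]_(p, q)) v :
  Wd *m v = a *: (W *m v) ->
  qf (Phi1 P W1 W2 Wd) v
  = qf P (W2 *m v) - qf P (W1 *m v)
    + a * (2 * bil P (W *m v) ((W2 - W1) *m v)).
Proof.
move=> Wdv; rewrite /Phi1 qfD qfB !qf_mul qf_He [qf (Wd^T *m P *m _) v]/qf.
by rewrite bil_mul Wdv bilZl; ring.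
Qed.

Lemma flatZ n p q (a : R) (B C : 'M['M[R]_n]_(p, q))
    (v : 'cV[R]_(\sum_(j < q) n)) :
  (forall i j, B i j = a *: C i j) -> flat B *m v = a *: (flat C *m v).
Proof.
move=> BC; rewrite scalemxAl; congr (_ *m _).
by apply/matrixP => i j; rewrite !mxE BC mxE.
Qed.

Lemma WdZ n d i j : Wd n (d%:R : R) i j = d%:R *: Wd n 1 i j.
Proof.
rewrite /Wd barray0 !col_mx_barray // !mxE /=.
case: i => -[|[|[|//]]] ? /=; case: j => -[|[|[|[|[|[|[|[|//]]]]]]]] ? /=;
  by rewrite ?scaler0 // scale_scalar_mx ?mulr1 ?mulrN1.
Qed.

End NegativeDefinite.

Section Switching.
Variables (R : realType) (n dn dM : nat) (A An Ad : 'M[R]_n).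
Hypotheses (n_gt0 : (0 < n)%N) (dn_dM : (dn <= dM)%N).
Implicit Types (y : nat -> 'cV[R]_n) (l : nat).
Local Notation ybar y := (\mxcol_(i < dM.+1) y i).
Local Notation M := (\sum_(i < dM.+1) n)%N.

Definition next_state y l : 'cV[R]_n := A *m y 0%N + An *m y dn + Ad *m y l.

Lemma sum_select (B : 'M[R]_n) k y : (k <= dM)%N ->
  \sum_(i < dM.+1) (if i == k :> nat then B else 0) *m y i = B *m y k.
Proof.
move=> kM; have kM' : (k < dM.+1)%N by [].
rewrite (bigD1 (Ordinal kM')) //= eqxx big1 ?addr0 // => i.
by rewrite -val_eqE /= => /negPf ->; rewrite mul0mx.
Qed.

Lemma La_ybar l y : (0 < l <= dM)%N -> La dn dM A An Ad l *m ybar y = next_state y l.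
Proof.
move=> /andP[l_gt0 lM]; rewrite /La mulmxDl -mulmxA !mul_mxrow_mxcol.
under eq_bigr do rewrite mulmxDl.
rewrite big_split /= (sum_select A) // (sum_select An) //; congr (_ + _ *m _).
transitivity (\sum_(i < dM.+1) (if i == l :> nat then 1 else 0 : 'M[R]_n) *m y i).
  apply: eq_bigr => i _; congr (_ *m _).
  by case: eqP => [->|]; rewrite ?l_gt0 ?andbF.
by rewrite sum_select // mul1mx.
Qed.

Lemma qf_castmx N N' (e : N = N') (S : 'M[R]_N) v :
  qf (castmx (e, e) S) v = qf S (castmx (esym e, erefl) v).
Proof. by subst N'; rewrite !castmx_id. Qed.

Lemma qf_diag0S N (S : 'M[R]_N) (x : 'cV[R]_n) v : qf (diag0S n S) (col_mx x v) = qf S v.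
Proof.
rewrite /qf /bil /diag0S tr_col_mx mul_row_block !mulmx0 !add0r mul_row_col.
by rewrite mul0mx add0r.
Qed.

Lemma qf_diagS0 (S : 'M[R]_M) x y :
  qf (diagS0 n S) (col_mx x (ybar y)) = qf S (ybar (cshift x y)).
Proof.
rewrite /diagS0 qf_castmx cast_shift // /qf /bil tr_col_mx mul_row_block.
by rewrite !mulmx0 !addr0 mul_row_col mul0mx addr0.
Qed.

(** On a window, [Lperp] stacks the next state on top; the two embedded matrices then read off the
    new window without its oldest state and the old window. [0 < lo] is required because [La] puts
    [Ad] only in blocks 1 to dM. *)
Lemma switch_decrease (S S' : 'M[R]_M) lo hi : (0 < lo)%N -> (hi <= dM)%N ->
  (forall l, (lo <= l <= hi)%N ->
    ((Lperp dn dM A An Ad l)^T *m (diagS0 n S - diag0S n S')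
      *m Lperp dn dM A An Ad l) \prec 0) ->
  exists2 c : R, 0 < c & forall l y i, (lo <= l <= hi)%N ->
    qf S (ybar (cshift (next_state y l) y)) <= qf S' (ybar y) - c * y 0%N i 0 ^+ 2.
Proof.
move=> lo_gt0 hi_dM neg.
have [|l|c c0 H] := @uniform_const R hi.+1 (fun l c => (lo <= l)%N -> forall y i,
    qf S (ybar (cshift (next_state y l) y)) <= qf S' (ybar y) - c * y 0%N i 0 ^+ 2).
- move=> l c c' c'c H lo_l y i; apply: le_trans (H lo_l y i) _.
  by rewrite lerD2l lerN2 ler_wpM2r ?sqr_ge0.
- rewrite ltnS => l_hi; have [lo_l|_] := leqP lo l; last by exists 1.
  have l_range : (lo <= l <= hi)%N by rewrite lo_l.
  have [c c0 H] := loewner_neg_coord (neg l l_range); exists c => // _ y i.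
  have := H (ybar y) (tagnat.Rank ord0 i).
  rewrite mxcol_head qf_mul mul_col_mx La_ybar //; last first.
    by rewrite (leq_trans lo_gt0 lo_l) (leq_trans l_hi).
  by rewrite mul1mx qfB qf_diagS0 qf_diag0S; lra.
by exists c => // l y i /andP[lo_l l_hi]; exact: H.
Qed.

End Switching.

(** * Strict decrease and coercivity of the two functionals *)

Section ModeDecrease.
Variables (R : realType) (n dm dn dM : nat) (A An Ad : 'M[R]_n).
Hypotheses (dm_dn : (dm <= dn)%N) (dn_dM : (dn <= dM)%N).
Variables (P1 : 'M[R]_(\sum_(i < 4) n)) (P2 : 'M[R]_(\sum_(i < 3) n)).
Variables (Q1 Q2 Z1 Z2 : mode -> 'M[R]_n) (Q3 Z3 : 'M[R]_n).
Variable X : mode -> 'M[R]_(\sum_(i < 2) n).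
Hypotheses (P1_pos : posdefmx P1) (P2_pos : posdefmx P2).
Hypotheses (Z1_pos : forall j, posdefmx (Z1 j)) (Z2_pos : forall j, posdefmx (Z2 j)).
Hypotheses (Q3_pos : posdefmx Q3) (Z3_pos : posdefmx Z3).
Hypothesis Psi_pos : forall j, posdefmx (Psiz Z2 X j).
Local Notation ybar y := (\mxcol_(i < dM.+1) y i).

Lemma GammaTwo_bvec (y : nat -> 'cV[R]_n) d v1 v2 v3 :
  GammaTwo A An Ad *m bvec 7 [:: y 0%N; y dn; y d; y dM; v1; v2; v3]
  = bvec 8 [:: next_state dn A An Ad y d; y 0%N; y dn; y d; y dM; v1; v2; v3].
Proof.
rewrite /GammaTwo flat_col1 //; congr (bvec _ (_ :: _)).
by rewrite /= /bdot /= /next_state !mul0mx !addr0 -!addrA; congr (_ + (_ + _)).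
Qed.

Lemma GammaOne_bvec (y : nat -> 'cV[R]_n) d v1 v2 v3 v4 :
  GammaOne A An Ad *m bvec 9 [:: y 0%N; y dm; y d; y dn; v1; v2; v3; y dM; v4]
  = bvec 10 [:: next_state dn A An Ad y d; y 0%N; y dm; y d; y dn; v1; v2; v3; y dM; v4].
Proof.
rewrite /GammaOne flat_col1 //; congr (bvec _ (_ :: _)).
rewrite /= /bdot /= /next_state !mul0mx !addr0 add0r -!addrA; congr (_ + _).
by rewrite addrC.
Qed.

Lemma STwo_decrease :
  (GammaTwo A An Ad)^T *m PhiTwo dm dn dM P2 Q1 Q2 Z1 Z2 X dn
    *m GammaTwo A An Ad \prec 0 ->
  (GammaTwo A An Ad)^T *m PhiTwo dm dn dM P2 Q1 Q2 Z1 Z2 X dM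
    *m GammaTwo A An Ad \prec 0 ->
  exists2 c : R, 0 < c & forall (y : nat -> 'cV[R]_n) d i, (dn <= d <= dM)%N ->
    qf (STwo dm dn dM P2 Q1 Q2 Z1 Z2) (ybar (cshift (next_state dn A An Ad y d) y))
    <= qf (STwo dm dn dM P2 Q1 Q2 Z1 Z2) (ybar y) - c * y 0%N i 0 ^+ 2.
Proof.
move=> neg_lo neg_hi.
have [v|c c0 H] := loewner_neg_affine (M := fun d => (GammaTwo A An Ad)^T
  *m PhiTwo dm dn dM P2 Q1 Q2 Z1 Z2 X d *m GammaTwo A An Ad) neg_lo neg_hi.
  have E d : WdTwo R n d *m (GammaTwo A An Ad *m v)
      = d%:R *: (WdTwo R n 1 *m (GammaTwo A An Ad *m v)).
    by apply: flatZ => i j; exact: WdZ.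
  do 2!eexists; move=> d; rewrite qf_mul /PhiTwo qfD [X in X + _]qfD.
  by rewrite (qf_Phi1_affine _ _ _ (E d)) -addrA addrAC.
exists c => // y d i /andP[dn_d d_dM].
have [v1 m1] := mean_exists y 0 dn; have [v2 m2] := mean_exists y dn d.
have [v3 m3] := mean_exists y d dM.
(* [GammaTwo] prepends the next state, so block 0 of the reduced vector is x(k); negativity is kept
   only at its coordinate i. *)
have := H d (bvec 7 [:: y 0%N; y dn; y d; y dM; v1; v2; v3]) (tagnat.Rank ord0 i).
rewrite dn_d d_dM qf_mul GammaTwo_bvec bvec_head => /(_ isT).
have := STwo_decrement dm_dn dn_dM Q1 Q2 P2_pos Z1_pos Z2_pos Psi_pos
  (next_state dn A An Ad y d) dn_d d_dM m1 m2 m3.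
lra.
Qed.

Lemma SOne_decrease :
  (GammaOne A An Ad)^T *m PhiOne dm dn dM P1 Q1 Q2 Z1 Z2 X Q3 Z3 dm
    *m GammaOne A An Ad \prec 0 ->
  (GammaOne A An Ad)^T *m PhiOne dm dn dM P1 Q1 Q2 Z1 Z2 X Q3 Z3 dn
    *m GammaOne A An Ad \prec 0 ->
  exists2 c : R, 0 < c & forall (y : nat -> 'cV[R]_n) d i, (dm <= d <= dn)%N ->
    qf (SOne dm dn dM P1 Q1 Q2 Z1 Z2 Q3 Z3)
      (ybar (cshift (next_state dn A An Ad y d) y))
    <= qf (SOne dm dn dM P1 Q1 Q2 Z1 Z2 Q3 Z3) (ybar y) - c * y 0%N i 0 ^+ 2.
Proof.
move=> neg_lo neg_hi.
have [v|c c0 H] := loewner_neg_affine (M := fun d => (GammaOne A An Ad)^T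
  *m PhiOne dm dn dM P1 Q1 Q2 Z1 Z2 X Q3 Z3 d *m GammaOne A An Ad) neg_lo neg_hi.
  have E d : WdOne R n d *m (GammaOne A An Ad *m v)
      = d%:R *: (WdOne R n 1 *m (GammaOne A An Ad *m v)).
    apply: flatZ => i j; rewrite !mxE; case: splitP => k _; rewrite !mxE.
      by case: splitP => l _; rewrite ?WdZ // !mxE scaler0.
    by rewrite scaler0.
  do 2!eexists; move=> d; rewrite qf_mul /PhiOne qfD [X in X + _]qfD.
  by rewrite (qf_Phi1_affine _ _ _ (E d)) -addrA addrAC.
exists c => // y d i /andP[dm_d d_dn].
have [v1 m1] := mean_exists y 0 dm; have [v2 m2] := mean_exists y dm d.
have [v3 m3] := mean_exists y d dn; have [v4 m4] := mean_exists y dn dM.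
have := H d (bvec 9 [:: y 0%N; y dm; y d; y dn; v1; v2; v3; y dM; v4])
  (tagnat.Rank ord0 i).
rewrite dm_d d_dn qf_mul GammaOne_bvec bvec_head => /(_ isT).
have := SOne_decrement dm_dn dn_dM Q1 Q2 P1_pos Z1_pos Z2_pos Q3_pos Z3_pos Psi_pos
  (next_state dn A An Ad y d) dm_d d_dn m1 m2 m3 m4.
lra.
Qed.

(** The [P2]-term alone controls x(k), the first block of its argument; all other terms are
    nonnegative. *)
Lemma STwo_coercive : (forall j, posdefmx (Q1 j)) -> (forall j, posdefmx (Q2 j)) ->
  exists2 c : R, 0 < c & forall (y : nat -> 'cV[R]_n) i,
    c * y 0%N i 0 ^+ 2 <= qf (STwo dm dn dM P2 Q1 Q2 Z1 Z2) (ybar y).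
Proof.
move=> Q1_pos Q2_pos; have [c c0 H] := posdef_coord P2_pos.
exists c => // y i; rewrite STwoE //.
have := H (bvec 3 [:: y 0%N; \sum_(0 <= i < dn) y i.+1;
  \sum_(dn <= i < dM) y i.+1]) (tagnat.Rank ord0 i).
rewrite bvec_head.
have := qseg_ge0 0 dn y (Q1_pos Two); have := qseg_ge0 dn dM y (Q2_pos Two).
have := zseg_ge0 dM 0 dn y (Z1_pos Two).
have := zseg_ge0 dM dn dM y (Z2_pos Two).
lra.
Qed.

Lemma SOne_coercive : (forall j, posdefmx (Q1 j)) -> (forall j, posdefmx (Q2 j)) ->
  exists2 c : R, 0 < c & forall (y : nat -> 'cV[R]_n) i,
    c * y 0%N i 0 ^+ 2 <= qf (SOne dm dn dM P1 Q1 Q2 Z1 Z2 Q3 Z3) (ybar y).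
Proof.
move=> Q1_pos Q2_pos; have [c c0 H] := posdef_coord P1_pos.
exists c => // y i; rewrite SOneE //.
have := H (bvec 4 [:: y 0%N; \sum_(0 <= i < dm) y i.+1;
  \sum_(dm <= i < dn) y i.+1; \sum_(dn <= i < dM) y i.+1]) (tagnat.Rank ord0 i).
rewrite bvec_head.
have := qseg_ge0 0 dm y (Q1_pos One); have := qseg_ge0 dm dn y (Q2_pos One).
have := qseg_ge0 dn dM y Q3_pos.
have := zseg_ge0 dM 0 dm y (Z1_pos One).
have := zseg_ge0 dM dm dn y (Z2_pos One).
have := zseg_ge0 dM dn dM y Z3_pos.
lra.
Qed.

End ModeDecrease.

(** * Stability *)

Lemma history_step (R : realType) n (x : int -> 'cV[R]_n) k :
  history x k.+1 = cshift (x (k%:Z + 1)) (history x k).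
Proof.
apply: funext => -[|i]; rewrite /history /=; congr x; lia.
Qed.

Lemma history0 (R : realType) n (x : int -> 'cV[R]_n) k :
  history x k 0%N = x k%:Z.
Proof. by rewrite /history subr0. Qed.

Section LyapunovStability.
Variables (R : realType) (n dm dn dM : nat) (A An Ad : 'M[R]_n).
Variables (d : nat -> nat) (U : (nat -> 'cV[R]_n) -> R) (c C : R).
Hypotheses (n_gt0 : (0 < n)%N) (c_gt0 : 0 < c) (C_ge0 : 0 <= C).
Hypothesis d_range : forall k, (dm <= d k <= dM)%N.
Hypothesis U_lower : forall (y : nat -> 'cV[R]_n) i, c * y 0%N i 0 ^+ 2 <= U y.
Hypothesis U_upper : forall (y : nat -> 'cV[R]_n) (r : R),
  (forall j i, (j <= dM)%N -> `|y j i 0| <= r) -> U y <= C * r ^+ 2.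
Hypothesis U_step : forall k (y : nat -> 'cV[R]_n) i,
  U (cshift (next_state dn A An Ad y (d k)) y) <= U y - c * y 0%N i 0 ^+ 2.

(** In each mode one of [Alo], [Ahi] is zero and the other is [An], sitting at delay dn, so
    switching changes the description and not the dynamics. *)
Lemma fsysE (y : nat -> 'cV[R]_n) k :
  fsys dm dn dM A An Ad d (sigma dm dn d k) y k = next_state dn A An Ad y (d k).
Proof.
by rewrite /fsys /next_state; case: (sigma _ _ _ _); rewrite /= mul0mx addr0.
Qed.

Lemma solution_step phi x k i : switched_solution dm dn dM A An Ad d phi x ->
  U (history x k.+1) <= U (history x k) - c * x k%:Z i 0 ^+ 2.
Proof.
move=> [step _]; have := U_step k (history x k) i.
by rewrite history_step step fsysE history0.
Qed.

Lemma lyapunov_stable : asymptotically_stable dm dn dM A An Ad d.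
Proof.
have dec phi x : switched_solution dm dn dM A An Ad d phi x ->
    forall k, U (history x k.+1) <= U (history x k).
  move=> sol k; apply: le_trans (solution_step k (Ordinal n_gt0) sol) _.
  by rewrite gerBl mulr_ge0 ?sqr_ge0 ?ltW.
have low (x : int -> 'cV[R]_n) k i : c * x k%:Z i 0 ^+ 2 <= U (history x k).
  by rewrite -history0; exact: U_lower.
split=> [e e0|phi x sol]; last first.
  apply: (lyapunov_cvg0 c_gt0) => [k|k i|k].
  - by apply: le_trans (low x k (Ordinal n_gt0)); rewrite mulr_ge0 ?sqr_ge0 ?ltW.
  - exact: solution_step sol.
  - exact: dec sol k.
(* Chosen so that c K = C + c exceeds C: then c x_i^2 <= C (e / K)^2 < c K (e / K)^2 = c e^2 / K <=
   c e^2, the last step by K >= 1. *)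
pose K := C / c + 1.
have K_ge1 : 1 <= K by rewrite lerDr divr_ge0 // ltW.
have K_gt0 : 0 < K by exact: lt_le_trans K_ge1.
exists (e / K); first exact: divr_gt0.
move=> phi x sol small k; apply: cV_norm_lt => // i.
have U0 : U (history x k) <= C * (e / K) ^+ 2.
  apply: (@le_trans _ _ (U (history x 0%N))).
    by elim: k => // k; apply: le_trans; exact: dec sol k.
  apply: U_upper => j i' jM; rewrite /history.
  have j_range : - dM%:Z <= 0 - j%:Z <= 0 by lia.
  rewrite sol.2 //; apply: le_trans (cV_norm_coord _ _) _.
  exact/ltW/small.
rewrite -(ltr_pXn2r (n := 2)) ?nnegrE ?normr_ge0 ?ltW //.
rewrite real_normK ?num_real //.
have eK : 0 < (e / K) ^+ 2 by rewrite exprn_gt0 // divr_gt0.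
apply: (@lt_le_trans _ _ (K * (e / K) ^+ 2)).
  rewrite -(ltr_pM2l c_gt0); apply: le_lt_trans (le_trans (low x k i) U0) _.
  have cK : c * K = C + c by rewrite /K mulrDr mulr1 mulrC divfK ?gt_eqF.
  by rewrite [c * _]mulrA cK ltr_pM2r // ltrDl.
have -> : K * (e / K) ^+ 2 = e ^+ 2 / K by field; rewrite gt_eqF.
by rewrite ler_pdivrMr // ler_peMr ?sqr_ge0.
Qed.

End LyapunovStability.

Theorem theorem1 (R : realType) (n dm dn dM : nat)
    (n_ge1 : (1 <= n)%N) (dm_ge1 : (1 <= dm)%N)
    (dm_le_dn : (dm <= dn)%N) (dn_le_dM : (dn <= dM)%N)
    (A An Ad : 'M[R]_n)
    (P1 : 'M[R]_(\sum_(i < 4) n)) (P2 : 'M[R]_(\sum_(i < 3) n))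
    (Q1 Q2 Z1 Z2 : mode -> 'M[R]_n) (X : mode -> 'M[R]_(\sum_(i < 2) n))
    (Q3 Z3 : 'M[R]_n)
    (P1_pos : posdefmx P1) (P2_pos : posdefmx P2)
    (Q1_pos : forall j, posdefmx (Q1 j)) (Q2_pos : forall j, posdefmx (Q2 j))
    (Z1_pos : forall j, posdefmx (Z1 j)) (Z2_pos : forall j, posdefmx (Z2 j))
    (Q3_pos : posdefmx Q3) (Z3_pos : posdefmx Z3)
    (Psi_pos : forall j, 0 \prec Psiz Z2 X j)
    (Phi_One_lo :
      (GammaOne A An Ad)^T *m PhiOne dm dn dM P1 Q1 Q2 Z1 Z2 X Q3 Z3 (dlo dm dn One)
        *m GammaOne A An Ad \prec 0)
    (Phi_One_hi :
      (GammaOne A An Ad)^T *m PhiOne dm dn dM P1 Q1 Q2 Z1 Z2 X Q3 Z3 (dhi dn dM One)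
        *m GammaOne A An Ad \prec 0)
    (Phi_Two_lo :
      (GammaTwo A An Ad)^T *m PhiTwo dm dn dM P2 Q1 Q2 Z1 Z2 X (dlo dm dn Two)
        *m GammaTwo A An Ad \prec 0)
    (Phi_Two_hi :
      (GammaTwo A An Ad)^T *m PhiTwo dm dn dM P2 Q1 Q2 Z1 Z2 X (dhi dn dM Two)
        *m GammaTwo A An Ad \prec 0)
    (switch_to_One : forall l : nat, (dlo dm dn One <= l <= dhi dn dM One)%N ->
      (Lperp dn dM A An Ad l)^T
        *m (diagS0 n (SOne dm dn dM P1 Q1 Q2 Z1 Z2 Q3 Z3)
            - diag0S n (STwo dm dn dM P2 Q1 Q2 Z1 Z2))
        *m Lperp dn dM A An Ad l \prec 0)
    (switch_to_Two : forall l : nat, (dlo dm dn Two <= l <= dhi dn dM Two)%N ->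
      (Lperp dn dM A An Ad l)^T
        *m (diagS0 n (STwo dm dn dM P2 Q1 Q2 Z1 Z2)
            - diag0S n (SOne dm dn dM P1 Q1 Q2 Z1 Z2 Q3 Z3))
        *m Lperp dn dM A An Ad l \prec 0)
    (d : nat -> nat) (d_range : forall k, (dm <= d k <= dM)%N) :
  asymptotically_stable dm dn dM A An Ad d.
Proof.
pose S1 := SOne dm dn dM P1 Q1 Q2 Z1 Z2 Q3 Z3.
pose S2 := STwo dm dn dM P2 Q1 Q2 Z1 Z2.
pose V S y := qf S (\mxcol_(i < dM.+1) y i : 'cV[R]_(\sum_(i < dM.+1) n)).
have Psi_pos' j : posdefmx (Psiz Z2 X j).
  by have := Psi_pos j; rewrite /loewner_lt subr0.
have [c1 c1_gt0 dec1] := SOne_decrease dm_le_dn dn_le_dM P1_pos Z1_pos Z2_pos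
  Q3_pos Z3_pos Psi_pos' Phi_One_lo Phi_One_hi.
have [c2 c2_gt0 dec2] := STwo_decrease dm_le_dn dn_le_dM P2_pos Z1_pos Z2_pos
  Psi_pos' Phi_Two_lo Phi_Two_hi.
have [c3 c3_gt0 co1] := SOne_coercive dm_le_dn dn_le_dM P1_pos Z1_pos Z2_pos
  Q3_pos Z3_pos Q1_pos Q2_pos.
have [c4 c4_gt0 co2] := STwo_coercive dm_le_dn dn_le_dM P2_pos Z1_pos Z2_pos
  Q1_pos Q2_pos.
have dn_gt0 : (0 < dn)%N := leq_trans dm_ge1 dm_le_dn.
have [c5 c5_gt0 sw1] := switch_decrease n_ge1 dn_le_dM dm_ge1 dn_le_dM switch_to_One.
have [c6 c6_gt0 sw2] := switch_decrease n_ge1 dn_le_dM dn_gt0 (leqnn dM) switch_to_Two.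
(* An upper bound for one functional is one for the minimum. *)
have [C C_ge0 bound] := qf_bound S1.
pose c := Num.min (Num.min c1 c2) (Num.min (Num.min c3 c4) (Num.min c5 c6)).
have c_gt0 : 0 < c.
  by rewrite !lt_min c1_gt0 c2_gt0 c3_gt0 c4_gt0 c5_gt0 c6_gt0.
have cM r a : c <= r -> c * a ^+ 2 <= r * a ^+ 2.
  by move=> cr; rewrite ler_wpM2r ?sqr_ge0.
have cB r a u v : c <= r -> u <= v - r * a ^+ 2 -> u <= v - c * a ^+ 2.
  by move=> /(cM r a); lra.
apply: (@lyapunov_stable R n dm dn dM A An Ad d
  (fun y => Num.min (V S1 y) (V S2 y)) c C) => //.
- move=> y i; rewrite le_min.
  by apply/andP; split; [apply: le_trans (co1 y i)|apply: le_trans (co2 y i)];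
    apply: cM; rewrite /c !ge_min !lexx ?orbT.
- move=> y r yr; rewrite ge_min; apply/orP; left; apply: bound => s.
  by rewrite mxE; apply: yr; rewrite -ltnS.
- move=> k y i; rewrite ge_min; have /andP[dm_d d_dM] := d_range k.
  (* The delay dn lies in both ranges and is assigned to mode One, as in [sigma]. In each case the
     functional of the active mode witnesses the minimum at the next step. *)
  have [d_dn|/ltnW dn_d] := leqP (d k) dn; apply/orP; [left|right].
    have dr : (dm <= d k <= dn)%N by rewrite dm_d.
    have h1 := cB _ _ _ _ _ (dec1 y _ i dr); have h2 := cB _ _ _ _ _ (sw1 _ y i dr).
    by rewrite lerBrDr le_min -!lerBrDr h1 ?h2 // /c !ge_min !lexx ?orbT.
  have dr : (dn <= d k <= dM)%N by rewrite dn_d.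
  have h1 := cB _ _ _ _ _ (sw2 _ y i dr); have h2 := cB _ _ _ _ _ (dec2 y _ i dr).
  by rewrite lerBrDr le_min -!lerBrDr h1 ?h2 // /c !ge_min !lexx ?orbT.
Qed.
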